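(* Let $V$ be the potential of the angular Teukolsky equation, with parameters $\Omega,\mu\in\mathbb{C}$ satisfying $|\Omega|>C_0$, $|\operatorname{Im}\Omega|<c$, and let $\alpha\in[\frac43,2)$ be a real number. Let $I=[u_{\min},u_1]\subset(0,\pi)$ be an interval for which there is $u_0<u_{\min}$ with $\operatorname{Re}V(u_0)=0$, $c^{-1}|\Omega|^2\le |\operatorname{Re}V'(u_0)|\le c|\Omega|^2$, $\operatorname{Re}V(u_{\min})=C|\Omega|^\alpha$, and $$\operatorname{Re}V|_I\ge\frac C2|\Omega|^\alpha ,\qquad |\operatorname{Im} V|\le c\,|\Omega|\ \text{ on } I.$$ Set $\varepsilon=\delta|\Omega|^{2-\frac{3\alpha}{2}}$ and $\nu=20\,\delta\,|\Omega|^{2-\frac{3\alpha}{2}}$, and assume that on $I$ $$\sup_I|V'|\le\varepsilon\inf_I|V|^{\frac32},\quad\sup_I|V''|\le\varepsilon^2\inf_I|V|^2,\quad\sup_I|V'''|\le\varepsilon^3\inf_I|V|^{\frac52},\qquad\big|\operatorname{Im}\sqrt V\big|\le\frac18\operatorname{Re}\sqrt V .$$ Then, for $\delta>0$ sufficiently small, $C$ sufficiently large (depending on $\delta$ and $c$) and $C_0$ sufficiently large, all independent of $\Omega$, the region $\mathcal{I}\cup\overline{\mathcal{I}}$ defined in the context is invariant on $I$ under the Riccati flow $y'=V-y^2$. Moreover, there is a constant $c'>0$ independent of $\Omega$ and $\mu$ such that on $I$ $$\frac1{c'}\,|\Omega|^{2-\frac{3\alpha}{2}}\sqrt{|V|}\le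 R+\beta\le c'\,|\Omega|^{2-\frac{3\alpha}{2}}\sqrt{|V|},\qquad |R^2-\beta^2|\le c'\,|\Omega|^{2-\frac{3\alpha}{2}}\,|V| .$$
   Context: Fix $s_0,k$ with $2s_0\in\mathbb{N}_0$, $k-s_0\in\mathbb{Z}$. The potential is $$V(u)=\Omega^2\sin^2u+\Big(k^2+s_0^2-\frac14\Big)\frac1{\sin^2u}-2s_0\Omega\cos u-2s_0k\,\frac{\cos u}{\sin^2u}-\mu,\qquad u\in(0,\pi).$$ $\sqrt V$ denotes the root with positive real part. With the driving function $f=-\frac{\varepsilon}{2}(1+i)\operatorname{Re}\sqrt V$, the approximate solution is $\tilde y=\sqrt V-\frac{V'}{4V}+f=:a+i\tilde\beta$ ($a,\tilde\beta$ real), which solves $\tilde y'=\tilde V-\tilde y^2$ with $$\tilde V=(\sqrt V+f)^2+\frac5{16}\frac{(V')^2}{V^2}-\frac14\frac{V''}{V}-\frac f2\frac{V'}{V}+f' .$$ Set $U=\operatorname{Re}V-a^2-a'$ and $\sigma(u)=|V|^{-\frac12}\exp\big((2-\varepsilon)\int_{u_{\min}}^u\operatorname{Re}\sqrt V\big)$ (so that $\sigma'=2a\sigma$), and $$\kappa(u)=\nu\sqrt{|V(u)|}+\frac1{\sigma(u)}\int_{u_{\min}}^u\sigma\operatorname{Im}(V-\tilde V).$$ The functions $R,\beta$ are given by $R+\beta=\tilde\beta+\kappa$, $R-\beta=U/(R+\beta)$. With $m=a+i\beta$, the set $\mathcal{I}=\mathcal{I}(u)$ is the intersection of the closed upper half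 plane with the disk of center $m$ and radius $R$: $\mathcal{I}=\{z\in\mathbb{C}: |z-m|\le R,\ \operatorname{Im}z\ge0\}$, and $\overline{\mathcal{I}}$ is its complex conjugate. Invariance of a family of regions $\mathcal{K}(u)$ under the Riccati flow on $I$ means: for every solution $y$ of $y'=V-y^2$ and all $v_0<v_1$ in $I$, $y(v_0)\in\mathcal{K}(v_0)$ implies $y(v_1)\in\mathcal{K}(v_1)$. *)

(* Defs.v *)
From Stdlib Require Import Reals Lra ZArith.
From Coquelicot Require Import Coquelicot.

Open Scope R_scope.

(* Derivative of a complex-valued function of one real variable; see
   [is_derive_Derive_RC] below. *)
Definition Derive_RC (g : R -> Complex.C) (u : R) : Complex.C :=
  (Derive (fun t => Re (g t)) u, Derive (fun t => Im (g t)) u).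

(* The square root with positive real part, off the half line (-oo, 0]; see
   [Csqrt_unique] below. *)
Definition Csqrt (z : Complex.C) : Complex.C :=
  let r := sqrt ((Cmod z + Re z) / 2) in (r, Im z / (2 * r)).

Definition sup_on (p q : R) (g : R -> R) : Rbar :=
  Lub_Rbar (fun x => exists u, p <= u <= q /\ x = g u).

Definition inf_on (p q : R) (g : R -> R) : Rbar :=
  Glb_Rbar (fun x => exists u, p <= u <= q /\ x = g u).

Definition teukolsky_potential (s0 k : R) (Omega mu : Complex.C) (u : R)
  : Complex.C :=
  (Omega * Omega * RtoC (sin u ^ 2)
   + RtoC ((k ^ 2 + s0 ^ 2 - 1 / 4) * (1 / sin u ^ 2))
   - RtoC 2 * RtoC s0 * Omega * RtoC (cos u)
   - RtoC (2 * s0 * k * (cos u / sin u ^ 2))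
   - mu)%C.

Definition driving (eps : R) (V : R -> Complex.C) (u : R) : Complex.C :=
  (RtoC (- (eps / 2)) * (RtoC 1 + Ci) * RtoC (Re (Csqrt (V u))))%C.

Definition ytilde (eps : R) (V : R -> Complex.C) (u : R) : Complex.C :=
  (Csqrt (V u) - Derive_RC V u / (RtoC 4 * V u) + driving eps V u)%C.

Definition Vtilde (eps : R) (V : R -> Complex.C) (u : R) : Complex.C :=
  let V' := Derive_RC V u in
  let V'' := Derive_RC (Derive_RC V) u in
  let f := driving eps V u in
  ((Csqrt (V u) + f) * (Csqrt (V u) + f)
   + RtoC (5 / 16) * ((V' * V') / (V u * V u))
   - RtoC (1 / 4) * (V'' / V u)
   - (f / RtoC 2) * (V' / V u)
   + Derive_RC (driving eps V) u)%C.

Definition afun (eps : R) (V : R -> Complex.C) (u : R) : R :=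
  Re (ytilde eps V u).

Definition betatilde (eps : R) (V : R -> Complex.C) (u : R) : R :=
  Im (ytilde eps V u).

Definition Ufun (eps : R) (V : R -> Complex.C) (u : R) : R :=
  Re (V u) - afun eps V u ^ 2 - Derive (afun eps V) u.

Definition sigma (eps umin : R) (V : R -> Complex.C) (u : R) : R :=
  / sqrt (Cmod (V u))
  * exp ((2 - eps) * RInt (fun t => Re (Csqrt (V t))) umin u).

Definition kappa (eps nu umin : R) (V : R -> Complex.C) (u : R) : R :=
  nu * sqrt (Cmod (V u))
  + 1 / sigma eps umin V u
    * RInt (fun t => sigma eps umin V t * Im (V t - Vtilde eps V t)%C) umin u.

(* [Rfun] and [betafun] solve the linear system R + beta = betatilde + kappa,
   R - beta = U / (R + beta); see [Rfun_plus_betafun] and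
   [Rfun_minus_betafun]. *)
Definition Rfun (eps nu umin : R) (V : R -> Complex.C) (u : R) : R :=
  let T := betatilde eps V u + kappa eps nu umin V u in
  (T + Ufun eps V u / T) / 2.

Definition betafun (eps nu umin : R) (V : R -> Complex.C) (u : R) : R :=
  let T := betatilde eps V u + kappa eps nu umin V u in
  (T - Ufun eps V u / T) / 2.

Definition Iregion (eps nu umin : R) (V : R -> Complex.C) (u : R)
  (z : Complex.C) : Prop :=
  let m : Complex.C := (afun eps V u, betafun eps nu umin V u) in
  Cmod (z - m)%C <= Rfun eps nu umin V u /\ 0 <= Im z.

Definition with_conj (K : R -> Complex.C -> Prop) (u : R) (z : Complex.C)
  : Prop :=
  K u z \/ exists w, K u w /\ z = Cconj w.

(* y' = V - y^2 on [p, q], the derivative being taken relative to [p, q]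
   (hence one-sided at the end points). *)
Definition riccati_solution (V : R -> Complex.C) (p q : R)
  (y : R -> Complex.C) : Prop :=
  forall u, p <= u <= q ->
    filterdiff (U := R_NormedModule) (V := C_R_NormedModule) y
      (within (fun t => p <= t <= q) (locally u))
      (fun h => scal h (V u - y u * y u)%C).

(* The solution is only required to exist on [v0, v1], so that solutions whose
   backward continuation leaves [p, q] by blowing up are covered too. *)
Definition riccati_invariant (V : R -> Complex.C) (p q : R)
  (K : R -> Complex.C -> Prop) : Prop :=
  forall (v0 v1 : R) (y : R -> Complex.C),
    p <= v0 -> v0 < v1 -> v1 <= q ->
    riccati_solution V v0 v1 y -> K v0 (y v0) -> K v1 (y v1).

Lemma is_derive_Derive_RC (g : R -> Complex.C) (u : R) (l : Complex.C) :
  is_derive (V := C_R_NormedModule) g u l -> Derive_RC g u = l.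
Proof.
intros H.
assert (H1 : is_derive (fun t => Re (g t)) u (Re l)).
{ apply (filterdiff_ext_lin _ (fun h : R => Re (scal h (l : C_R_NormedModule)))).
  - refine (filterdiff_comp' (U := R_NormedModule) (V := C_R_NormedModule)
              (W := R_NormedModule) g Re u (fun h : R => scal h (l : C_R_NormedModule)) Re H _).
    apply filterdiff_linear, is_linear_fst.
  - intros h; reflexivity. }
assert (H2 : is_derive (fun t => Im (g t)) u (Im l)).
{ apply (filterdiff_ext_lin _ (fun h : R => Im (scal h (l : C_R_NormedModule)))).
  - refine (filterdiff_comp' (U := R_NormedModule) (V := C_R_NormedModule)
              (W := R_NormedModule) g Im u (fun h : R => scal h (l : C_R_NormedModule)) Im H _).
    apply filterdiff_linear, is_linear_snd.
  - intros h; reflexivity. }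
apply injective_projections; apply is_derive_unique; assumption.
Qed.

Lemma Csqrt_unique (z w : Complex.C) :
  (w * w)%C = z -> 0 < Re w -> Csqrt z = w.
Proof.
intros <- Hw.
assert (Hm : Cmod (w * w) = Re w ^ 2 + Im w ^ 2).
{ rewrite Cmod_mult; unfold Cmod, Re, Im; apply sqrt_sqrt.
  apply Rplus_le_le_0_compat; apply pow2_ge_0. }
unfold Csqrt; rewrite Hm.
replace ((Re w ^ 2 + Im w ^ 2 + Re (w * w)) / 2) with (Re w * Re w)
  by (destruct w as [x y]; simpl; field).
rewrite sqrt_square by lra.
destruct w as [x y]; simpl in *; f_equal; field; lra.
Qed.

Lemma Rfun_plus_betafun eps nu umin V u :
  Rfun eps nu umin V u + betafun eps nu umin V u
  = betatilde eps V u + kappa eps nu umin V u.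
Proof. unfold Rfun, betafun; lra. Qed.

Lemma Rfun_minus_betafun eps nu umin V u :
  Rfun eps nu umin V u - betafun eps nu umin V u
  = Ufun eps V u / (Rfun eps nu umin V u + betafun eps nu umin V u).
Proof. rewrite Rfun_plus_betafun; unfold Rfun, betafun; lra. Qed.

(* Main.v *)
Require Import Defs.
From Stdlib Require Import Reals Lra ZArith Classical.
From Coquelicot Require Import Coquelicot.
Open Scope R_scope.

(** Write [w = r + i s] for the root of [V], [rho = |w|], and
    [q = g + i h = V' / (2 V) = w' / w].  Then [a], [betatilde], [U] and
    [Im (V - Vtilde)] are polynomials in [r, s, g, h, g', h'].  The hypotheses on the
    derivatives of [V] say that [q, q', q''] are of size [eps rho], [eps^2 rho^2],
    [eps^3 rho^3], and for large [|Omega|] the bound on [Im V] makes [Im V] small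
    against [eps rho^2] (lemma [large_frequency]).  This leaves [a ~ rho],
    [U ~ eps rho^2], [Im (V - Vtilde) ~ eps rho^2] and [|betatilde| <= eps rho]
    ([slowly_varying_bounds]).

    The integral in [kappa] is caught between [0] and [eps rho sigma] by comparing
    derivatives, so with [nu = 20 eps] the quantity [T = R + beta = betatilde + kappa]
    lies between [19 eps rho] and [22 eps rho].  Since [R^2 - beta^2 = U], this already
    gives the stated bounds on [R + beta] and [R^2 - beta^2].  It also gives
    [T < D], where [D = U / T = R - beta]: the center [m] lies below the real axis.

    For this reason the union of the half-disk and its conjugate is the
    intersection of the two full disks.  With [x = Re y - a] they are
    [x^2 + (Im y - T) (Im y + D) <= 0] and the same with [Im y] replaced by [- Im y]
    ([with_conj_Iregion]).  Along the Riccati flow the derivative of the first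
    expression at a point of its arc is affine in the height [Im y], which ranges
    from [0] to [T] ([lens_derivative]).  At the two ends it is negative as soon as
    [U' + 4 a U + 2 beta Im V > 0] (the corner on the real axis) and
    [T' + 2 a T > Im V] (the top).  The first holds because [4 a U ~ 4 eps rho^3]
    dominates.  The second holds because [kappa] is built so that
    [T' + 2 a T = Im V + nu (rho' + 2 a rho)].  Both have room to spare for replacing
    [Im V] by [- Im V], which is what the conjugate disk requires.  As the flow is
    strictly inward on the whole boundary, the intersection cannot be left
    ([barrier]). *)

(** * Real analysis: barriers and one-sided derivatives *)

Lemma is_derive_continuous (f : R -> R) (u l : R) :
  is_derive f u l -> continuous f u.
Proof. intros H; apply (ex_derive_continuous f u); exists l; exact H. Qed.

Lemma nondecreasing_of_derive (f df : R -> R) (a b : R) :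
  a <= b ->
  (forall u, a <= u <= b -> is_derive f u (df u)) ->
  (forall u, a <= u <= b -> 0 <= df u) ->
  f a <= f b.
Proof.
intros Hab Hd Hpos.
destruct (MVT_gen f a b df) as [x [Hx E]].
- rewrite Rmin_left, Rmax_right by lra; intros u Hu; apply Hd; lra.
- rewrite Rmin_left, Rmax_right by lra; intros u Hu.
  apply continuity_pt_filterlim; apply (is_derive_continuous f u (df u)), Hd; lra.
- rewrite Rmin_left, Rmax_right in Hx by lra.
  assert (0 <= df x * (b - a)) by (apply Rmult_le_pos; [apply Hpos | ]; lra).
  lra.
Qed.

(** At a zero the negative derivative pushes [E] below zero; elsewhere
    continuity is enough. *)
Lemma stays_nonpositive_right (E : R -> R) (u d : R) :
  is_derive E u d -> E u <= 0 -> (E u = 0 -> d < 0) ->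
  exists e : R, 0 < e /\ forall t, u <= t < u + e -> E t <= 0.
Proof.
intros Hd Hu Hs.
destruct (Rle_lt_or_eq_dec _ _ Hu) as [Hlt | Heq].
- destruct (proj1 (filterlim_locally _ _) (is_derive_continuous _ _ _ Hd)
     (mkposreal (- E u) ltac:(lra))) as [e He].
  exists e; split; [apply cond_pos | ]; intros t Ht.
  assert (Hb : ball u e t) by (apply Rabs_def1; unfold minus, plus, opp; simpl; lra).
  apply He, Rabs_def2 in Hb; unfold minus, plus, opp in Hb; simpl in Hb; lra.
- specialize (Hs Heq).
  destruct (proj1 (is_derive_Reals _ _ _) Hd (- d) ltac:(lra)) as [e He].
  exists e; split; [apply cond_pos | ]; intros t Ht.
  destruct (Req_dec t u) as [-> | Hne]; [lra | ].
  specialize (He (t - u) ltac:(lra)).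
  rewrite Rabs_pos_eq in He by lra.
  specialize (He ltac:(lra)); apply Rabs_def2 in He.
  replace (u + (t - u)) with t in He by ring.
  assert (Hq : (E t - E u) / (t - u) < 0) by lra.
  assert (E t - E u = (E t - E u) / (t - u) * (t - u)) by (field; lra).
  assert ((E t - E u) / (t - u) * (t - u) < 0) by nra.
  lra.
Qed.

Lemma nonpositive_left_limit (E : R -> R) (a m : R) :
  continuous E m -> a < m -> (forall t, a <= t < m -> E t <= 0) -> E m <= 0.
Proof.
intros Hc Ham Ht; apply Rnot_lt_le; intros Hpos.
destruct (proj1 (filterlim_locally _ _) Hc (mkposreal _ Hpos)) as [e He].
pose proof (cond_pos e) as He0.
set (t := Rmax a (m - e / 2)).
assert (a <= t < m /\ m - e / 2 <= t).
{ unfold t; split; [split | ]; [apply Rmax_l | apply Rmax_lub_lt; lra | apply Rmax_r]. }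
assert (Hb : ball m e t) by (apply Rabs_def1; unfold minus, plus, opp; simpl; lra).
apply He, Rabs_def2 in Hb; unfold minus, plus, opp in Hb; simpl in Hb.
specialize (Ht t ltac:(lra)); lra.
Qed.

(** Two simultaneous constraints, each strictly inward on the part of its
    boundary where the other one holds.  The last time up to which both hold
    cannot lie before [b], since both persist a little beyond it. *)
Lemma barrier (E1 E2 d1 d2 : R -> R) (a b : R) :
  a <= b ->
  (forall u, a <= u <= b -> is_derive E1 u (d1 u)) ->
  (forall u, a <= u <= b -> is_derive E2 u (d2 u)) ->
  (forall u, a <= u <= b -> E1 u = 0 -> E2 u <= 0 -> d1 u < 0) ->
  (forall u, a <= u <= b -> E2 u = 0 -> E1 u <= 0 -> d2 u < 0) ->
  E1 a <= 0 -> E2 a <= 0 -> E1 b <= 0 /\ E2 b <= 0.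
Proof.
intros Hab HD1 HD2 Hs1 Hs2 Ha1 Ha2.
pose (S x := a <= x <= b /\ forall t, a <= t <= x -> E1 t <= 0 /\ E2 t <= 0).
assert (Sa : S a).
{ split; [lra | ]; intros t Ht; replace t with a by lra; auto. }
destruct (completeness S) as [m [Hub Hleast]].
- exists b; intros x [Hx _]; lra.
- exists a; exact Sa.
- assert (Ham : a <= m) by (apply Hub, Sa).
  assert (Hmb : m <= b) by (apply Hleast; intros x [Hx _]; lra).
  assert (Hlt : forall t, a <= t < m -> E1 t <= 0 /\ E2 t <= 0).
  { intros t Ht; apply NNPP; intros Hn.
    assert (m <= t); [ | lra].
    apply Hleast; intros x [Hx1 Hx2]; apply Rnot_lt_le; intros Hxt.
    apply Hn, Hx2; lra. }
  assert (Hm : E1 m <= 0 /\ E2 m <= 0).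
  { destruct (Req_dec a m) as [<- | Hne]; [auto | ].
    split; apply (nonpositive_left_limit _ a).
    1: apply (is_derive_continuous _ _ (d1 m)), HD1; lra.
    3: apply (is_derive_continuous _ _ (d2 m)), HD2; lra.
    1, 3: lra.
    all: intros t Ht; apply Hlt, Ht. }
  destruct (Rle_lt_or_eq_dec _ _ Hmb) as [Hmb' | ->]; [exfalso | exact Hm].
  destruct Hm as [Hm1 Hm2].
  destruct (stays_nonpositive_right E1 m (d1 m) (HD1 m ltac:(lra)) Hm1
    (fun H => Hs1 m ltac:(lra) H Hm2)) as [e1 [He1 Hr1]].
  destruct (stays_nonpositive_right E2 m (d2 m) (HD2 m ltac:(lra)) Hm2
    (fun H => Hs2 m ltac:(lra) H Hm1)) as [e2 [He2 Hr2]].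
  set (e := Rmin (b - m) (Rmin (e1 / 2) (e2 / 2))).
  assert (He : 0 < e /\ e <= b - m /\ e < e1 /\ e < e2).
  { unfold e, Rmin; repeat destruct Rle_dec; lra. }
  assert (m + e <= m); [ | lra].
  apply Hub; split; [lra | ]; intros t Ht.
  destruct (Rlt_dec t m) as [Htm | Htm]; [apply Hlt; lra | ].
  split; [apply Hr1 | apply Hr2]; lra.
Qed.

(** A derivative relative to a closed interval becomes an ordinary derivative
    once the function is continued by its tangent lines; the product and
    quotient rules for two-sided derivatives then apply at the end points
    too. *)
Lemma extend_past_endpoints (f l : R -> R) (a b : R) :
  a < b ->
  (forall u, a <= u <= b -> forall e : posreal, exists d : posreal,
     forall t, a <= t <= b -> Rabs (t - u) < d ->
     Rabs (f t - f u - (t - u) * l u) <= e * Rabs (t - u)) ->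
  exists F : R -> R,
    forall u, a <= u <= b -> F u = f u /\ is_derive F u (l u).
Proof.
intros Hab Hf.
pose (F t := if Rlt_dec t a then f a + (t - a) * l a
             else if Rlt_dec b t then f b + (t - b) * l b else f t).
assert (Fin : forall u, a <= u <= b -> F u = f u).
{ intros u Hu; unfold F; destruct Rlt_dec; [lra | ]; destruct Rlt_dec; [lra | reflexivity]. }
exists F; intros u Hu; split; [now apply Fin | ].
apply is_derive_Reals; intros e He.
destruct (Hf u Hu (mkposreal (e / 2) ltac:(lra))) as [d Hd]; simpl in Hd.
(* On the ball of radius [d'] only the tangent line at [u] itself, if [u] is an
   end point, is met. *)
assert (Hd' : exists d' : posreal, d' <= d /\ d' <= b - a /\ (a < u -> d' <= u - a)
   /\ (u < b -> d' <= b - u)).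
{ pose proof (cond_pos d).
  destruct (Req_dec a u) as [E1 | N1]; destruct (Req_dec u b) as [E2 | N2]; [lra | | | ].
  - unshelve eexists (mkposreal (Rmin d (b - a)) _); unfold Rmin;
      simpl; destruct Rle_dec; lra.
  - unshelve eexists (mkposreal (Rmin d (b - a)) _); unfold Rmin;
      simpl; destruct Rle_dec; lra.
  - unshelve eexists (mkposreal (Rmin d (Rmin (u - a) (b - u))) _); unfold Rmin;
      simpl; repeat destruct Rle_dec; lra. }
destruct Hd' as [d' [Hdd [Hba [Hua Hub]]]].
exists d'; intros h Hh0 Hh.
apply Rabs_def2 in Hh as Hh2.
assert (Hm : Rabs (F (u + h) - F u - h * l u) <= e / 2 * Rabs h).
{ rewrite (Fin u Hu).
  assert (0 <= e / 2 * Rabs h) by (apply Rmult_le_pos; [lra | apply Rabs_pos]).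
  unfold F; destruct Rlt_dec as [H1 | H1]; [ | destruct Rlt_dec as [H2 | H2]].
  - destruct (Req_dec a u) as [<- | N]; [ | lra].
    replace (f a + (a + h - a) * l a - f a - h * l a) with 0 by ring.
    rewrite Rabs_R0; assumption.
  - destruct (Req_dec u b) as [-> | N]; [ | lra].
    replace (f b + (b + h - b) * l b - f b - h * l b) with 0 by ring.
    rewrite Rabs_R0; assumption.
  - specialize (Hd (u + h)); replace (u + h - u) with h in Hd by ring.
    apply Hd; lra. }
replace ((F (u + h) - F u) / h - l u) with ((F (u + h) - F u - h * l u) / h)
  by (field; assumption).
unfold Rdiv; rewrite Rabs_mult, Rabs_inv.
assert (0 < Rabs h) by (apply Rabs_pos_lt; assumption).
apply (Rmult_lt_reg_r (Rabs h)); [assumption | ].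
rewrite Rmult_assoc, Rinv_l by lra; nra.
Qed.

Lemma im_le_Cmod (z : Complex.C) : Rabs (Im z) <= Cmod z.
Proof. eapply Rle_trans; [apply Rmax_r | apply Rmax_Cmod]. Qed.

Lemma norm_Cmod (z : C_R_NormedModule) : norm z = Cmod z.
Proof.
change (sqrt (Rabs (fst z) ^ 2 + Rabs (snd z) ^ 2) = Cmod z).
rewrite !pow2_abs; reflexivity.
Qed.

Lemma riccati_extension (V : R -> Complex.C) (p q : R) (y : R -> Complex.C) :
  p < q -> riccati_solution V p q y ->
  exists y1 y2 : R -> R, forall u, p <= u <= q ->
    y1 u = Re (y u) /\ y2 u = Im (y u) /\
    is_derive y1 u (Re (V u - y u * y u)%C) /\
    is_derive y2 u (Im (V u - y u * y u)%C).
Proof.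
intros Hpq Hy.
assert (H : forall u, p <= u <= q -> forall e : posreal, exists d : posreal,
   forall t, p <= t <= q -> Rabs (t - u) < d ->
   Rabs (Re (y t) - Re (y u) - (t - u) * Re (V u - y u * y u)%C) <= e * Rabs (t - u) /\
   Rabs (Im (y t) - Im (y u) - (t - u) * Im (V u - y u * y u)%C) <= e * Rabs (t - u)).
{ intros u Hu e.
  destruct (Hy u Hu) as [_ Hl].
  assert (Hlim : is_filter_lim (within (fun t => p <= t <= q) (locally u)) u).
  { intros P HP; apply filter_le_within; exact HP. }
  destruct (Hl u Hlim e) as [d Hd].
  exists d; intros t Ht Htd.
  specialize (Hd t Htd Ht).
  rewrite norm_Cmod in Hd.
  change (norm (minus t u)) with (Rabs (t - u)) in Hd.
  set (z := minus _ _ : C_R_NormedModule) in Hd.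
  pose proof (re_le_Cmod z) as H1; pose proof (im_le_Cmod z) as H2.
  split; eapply Rle_trans; [ | exact Hd | | exact Hd].
  - eapply Rle_trans; [right | exact H1]; f_equal.
  - eapply Rle_trans; [right | exact H2]; f_equal. }
destruct (extend_past_endpoints (fun t => Re (y t))
  (fun u => Re (V u - y u * y u)%C) p q Hpq) as [F1 HF1].
{ intros u Hu e; destruct (H u Hu e) as [d Hd]; exists d; intros; apply Hd; auto. }
destruct (extend_past_endpoints (fun t => Im (y t))
  (fun u => Im (V u - y u * y u)%C) p q Hpq) as [F2 HF2].
{ intros u Hu e; destruct (H u Hu e) as [d Hd]; exists d; intros; apply Hd; auto. }
exists F1, F2; intros u Hu.
destruct (HF1 u Hu), (HF2 u Hu); auto.
Qed.

(** Convexity of [D] keeps the integrand continuous between the base point and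
    every point near [u], on either side of the base point. *)
Lemma is_derive_RInt_on_open (D : R -> Prop) (F : R -> R) (p u : R) :
  (forall x, D x -> locally x D) ->
  (forall x y z, D x -> D y -> x <= z <= y -> D z) ->
  (forall x, D x -> continuous F x) -> D p -> D u ->
  is_derive (fun t => RInt F p t) u (F u).
Proof.
intros HD Hconv HF Hp Hu.
apply (is_derive_RInt F (fun t => RInt F p t) p u); [ | apply HF, Hu].
apply (filter_imp D); [ | apply HD, Hu]; intros t Ht.
apply (RInt_correct F), (ex_RInt_continuous F); intros z Hz; apply HF.
unfold Rmin, Rmax in Hz; destruct Rle_dec; [apply (Hconv p t) | apply (Hconv t p)];
  assumption.
Qed.

(** * The flow across the boundary of the lens *)

(** The left side is [T] times the derivative of [x^2 + (y - T) (y + D)] along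
    [x' = U - 2 a x - x^2 + y^2], [y' = v - 2 (a + x) y].  These are the two
    components of the Riccati equation in terms of [x = Re y - a], with [v] for
    [Im V] and [U = Re V - a^2 - a'].  On the arc the terms nonlinear in [x]
    cancel, and what is left is affine in the height [y]: it interpolates between
    the corner, [y = 0], and the top of the arc, [y = T]. *)
Lemma lens_derivative (a v T U D T' U' D' x y : R) :
  U = T * D -> T * D' = U' - T' * D ->
  x * x + (y - T) * (y + D) = 0 ->
  T * (2 * x * (U - 2 * a * x - x * x + y * y)
       + (v - 2 * (a + x) * y - T') * (y + D)
       + (y - T) * (v - 2 * (a + x) * y + D'))
  = - (y * (T + D) * (T' + 2 * a * T - v)
       + (T - y) * (U' + 4 * a * (T * D) + (T - D) * v)).
Proof.
intros -> HD' Harc.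
assert (Hx : x * x = (T - y) * (y + D)) by lra.
replace U' with (T * D' + T' * D) by lra.
(* Only [x * x] may be eliminated by the equation of the arc. *)
replace (2 * x * (T * D - 2 * a * x - x * x + y * y))
  with (2 * x * (T * D - x * x + y * y) - 4 * a * (x * x)) by ring.
rewrite Hx; ring.
Qed.

(** Being also inside the conjugate disk forces [0 <= y <= T], so the affine
    function of [lens_derivative] is evaluated between its two end values. *)
Lemma lens_inward (a v T U D T' U' D' x y : R) :
  0 < T -> T < D -> U = T * D -> T * D' = U' - T' * D ->
  v < T' + 2 * a * T -> 0 < U' + 4 * a * U + (T - D) * v ->
  x * x + (y - T) * (y + D) = 0 -> x * x + (y + T) * (y - D) <= 0 ->
  2 * x * (U - 2 * a * x - x * x + y * y)
  + (v - 2 * (a + x) * y - T') * (y + D)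
  + (y - T) * (v - 2 * (a + x) * y + D') < 0.
Proof.
intros HT HTD HU HD' Htop Hcorner Harc Hother.
assert (Hy0 : 0 <= y) by nra.
assert (HyT : y <= T).
{ apply Rnot_lt_le; intros Hy.
  assert (0 < (y - T) * (y + D)) by (apply Rmult_lt_0_compat; lra).
  pose proof (Rle_0_sqr x); unfold Rsqr in *; lra. }
apply (Rmult_lt_reg_l T); [assumption | ].
rewrite (lens_derivative a v T U D T' U' D' x y HU HD' Harc), Rmult_0_r, <- HU.
assert (H1 : 0 <= y * (T + D)) by (apply Rmult_le_pos; lra).
assert (H2 : 0 <= y * (T + D) * (T' + 2 * a * T - v)) by (apply Rmult_le_pos; lra).
assert (H3 : 0 <= (T - y) * (U' + 4 * a * U + (T - D) * v))
  by (apply Rmult_le_pos; lra).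
destruct (Rle_lt_or_eq_dec _ _ Hy0) as [Hy | <-].
- assert (0 < y * (T + D) * (T' + 2 * a * T - v))
    by (repeat apply Rmult_lt_0_compat; lra).
  lra.
- assert (0 < (T - 0) * (U' + 4 * a * U + (T - D) * v))
    by (apply Rmult_lt_0_compat; lra).
  lra.
Qed.

(** * Size of the coefficients *)

(** Bounds at one point, for [w = r + i s] the root of [V],
    [q = g + i h = V' / (2 V) = w' / w], with derivative [g1 + i h1] and second
    derivative of real part [g2], and [rho = |w|].  Each derivative of [q] gains a
    factor [eps * rho], so after rescaling by powers of [rho] only powers of
    [eps] remain. *)
Record slowly_varying (eps r s g h g1 h1 g2 rho : R) : Prop := {
  sv_eps : 0 < eps < 1 / 1000;
  sv_r : 0 < r;
  sv_rho : 0 < rho;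
  sv_mod : rho ^ 2 = r ^ 2 + s ^ 2;
  sv_s : Rabs s <= 1 / 8 * r;
  sv_im : Rabs (2 * r * s) <= eps * rho ^ 2 / 16;
  sv_g : Rabs g <= eps * rho / 2;
  sv_h : Rabs h <= eps * rho / 2;
  sv_g1 : Rabs g1 <= eps ^ 2 * rho ^ 2;
  sv_h1 : Rabs h1 <= eps ^ 2 * rho ^ 2;
  sv_g2 : Rabs g2 <= 3 * eps ^ 3 * rho ^ 3
}.

(** In terms of [r, s, g, h] and their derivatives the quantities of the
    construction are polynomials.  Since [V = w^2], [V' = 2 w^2 q] and
    [w' = q w], these formulas are [a], [betatilde], [U], [U'] and
    [Im (V - Vtilde)], respectively.  In [U], the terms of order [eps * rho^2]
    coming from [a^2] and [a'] cancel except for [eps * r^2]: what remains of them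
    carries a factor [s]. *)
Definition a_of_root (eps r g : R) := (1 - eps / 2) * r - g / 2.
Definition betatilde_of_root (eps r s h : R) := s - h / 2 - eps / 2 * r.
Definition U_of_root (eps r s g h g1 : R) :=
  (eps - eps ^ 2 / 4) * r ^ 2 - s ^ 2 + (1 - eps / 2) * (h * s)
  - g ^ 2 / 4 + g1 / 2.
Definition dU_of_root (eps r s g h g1 h1 g2 : R) :=
  2 * (eps - eps ^ 2 / 4) * r * (g * r - h * s) - 2 * s * (g * s + h * r)
  + (1 - eps / 2) * (h1 * s + h * (g * s + h * r)) - g * g1 / 2 + g2 / 2.
Definition defect_of_root (eps r s g h h1 : R) :=
  eps * r * (r + s) - eps ^ 2 * r ^ 2 / 2 + h1 / 2 - g * h / 2
  - eps / 2 * h * (r + s).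

Lemma Rabs_mult_le (x y p q : R) :
  Rabs x <= p -> Rabs y <= q -> Rabs (x * y) <= p * q.
Proof.
intros; rewrite Rabs_mult; apply Rmult_le_compat; auto using Rabs_pos.
Qed.

(** Homogeneity: [r, s, g, h] have weight one in [rho], and each derivative adds
    one. *)
Lemma slowly_varying_normalized (eps r s g h g1 h1 g2 rho : R) :
  slowly_varying eps r s g h g1 h1 g2 rho ->
  slowly_varying eps (r / rho) (s / rho) (g / rho) (h / rho) (g1 / rho ^ 2)
    (h1 / rho ^ 2) (g2 / rho ^ 3) 1.
Proof.
intros [He Hr Hrho Hm Hs Hi Hg Hh Hg1 Hh1 Hg2].
assert (Hi0 : 0 < / rho) by now apply Rinv_0_lt_compat.
assert (Habs : forall x n, Rabs (x / rho ^ n) = Rabs x / rho ^ n).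
{ intros x n; unfold Rdiv; rewrite Rabs_mult, (Rabs_pos_eq (/ rho ^ n)); auto.
  left; apply Rinv_0_lt_compat, pow_lt; assumption. }
assert (Habs1 : forall x, Rabs (x / rho) = Rabs x / rho).
{ intros x; specialize (Habs x 1%nat); now rewrite pow_1 in Habs. }
assert (Hle : forall n x b, Rabs x <= b * rho ^ n -> Rabs x / rho ^ n <= b).
{ intros n x b H; assert (0 < rho ^ n) by (apply pow_lt; assumption).
  apply (Rmult_le_reg_r (rho ^ n)); [assumption | ].
  unfold Rdiv; rewrite Rmult_assoc, Rinv_l by lra; lra. }
assert (Hle1 : forall x b, Rabs x <= b * rho -> Rabs x / rho <= b).
{ intros x b H; specialize (Hle 1%nat x b); rewrite pow_1 in Hle; auto. }
constructor; auto; try lra; rewrite ?Habs, ?Habs1.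
- apply Rdiv_lt_0_compat; assumption.
- replace (1 ^ 2) with (rho ^ 2 / rho ^ 2) by (field; lra); rewrite Hm at 1;
    field; lra.
- unfold Rdiv at 1 3; nra.
- replace (2 * (r / rho) * (s / rho)) with ((2 * r * s) / rho ^ 2) by (field; lra).
  rewrite Habs; apply Hle; lra.
- apply Hle1; lra.
- apply Hle1; lra.
- apply Hle; lra.
- apply Hle; lra.
- apply Hle; lra.
Qed.

(** The bound on [2 r s = Im V] makes [s] smaller than [r] by a factor [eps];
    the bound by [r / 8] first keeps [r] close to [rho]. *)
Lemma slowly_varying_s (eps r s g h g1 h1 g2 : R) :
  slowly_varying eps r s g h g1 h1 g2 1 ->
  99 / 100 <= r <= 1 /\ 98 / 100 <= r ^ 2 <= 1 /\ Rabs s <= eps / 30.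
Proof.
intros [He Hr Hrho Hm Hs Hi Hg Hh Hg1 Hh1 Hg2].
assert (Hs2 : s ^ 2 <= r ^ 2 / 64).
{ rewrite <- (pow2_abs s); assert (0 <= Rabs s) by apply Rabs_pos; nra. }
assert (0 <= s ^ 2) by apply pow2_ge_0.
assert (Hr2 : 64 / 65 <= r ^ 2 <= 1) by lra.
assert (Hr1 : 99 / 100 <= r <= 1) by nra.
repeat split; try lra.
rewrite Rabs_mult, (Rabs_pos_eq (2 * r)) in Hi by lra.
assert (0 <= Rabs s) by apply Rabs_pos; nra.
Qed.

Ltac split_abs_bounds := repeat match goal with
  | H : Rabs _ <= _ |- _ => apply Rabs_le_between in H end.

(** In each expression the term [eps * r^2] (or [r]) dominates, and the others
    are products of at least two small factors; every such product is bounded in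
    turn, after which the estimates are linear in the monomials. *)
Lemma normalized_bounds (eps r s g h g1 h1 g2 : R) :
  slowly_varying eps r s g h g1 h1 g2 1 ->
  (97 / 100 <= a_of_root eps r g <= 101 / 100) /\
  Rabs (betatilde_of_root eps r s h) <= 8 / 10 * eps /\
  (9 / 10 * eps <= U_of_root eps r s g h g1 <= 102 / 100 * eps) /\
  Rabs (dU_of_root eps r s g h g1 h1 g2) <= 3 * eps ^ 2 /\
  (0 <= defect_of_root eps r s g h h1 <= 12 / 10 * eps).
Proof.
intros Hsv.
destruct (slowly_varying_s _ _ _ _ _ _ _ _ Hsv) as [Hr1 [Hr2 Hs]].
destruct Hsv as [He Hr Hrho Hm Hs' Hi Hg Hh Hg1 Hh1 Hg2].
rewrite ?pow1, ?Rmult_1_r in *.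
assert (Re1 : Rabs eps <= eps) by (rewrite Rabs_pos_eq; lra).
assert (Rr : Rabs r <= 1) by (rewrite Rabs_pos_eq; lra).
pose proof (Rabs_mult_le _ _ _ _ Hg Rr) as Hgr.
pose proof (Rabs_mult_le _ _ _ _ Hh Rr) as Hhr.
pose proof (Rabs_mult_le _ _ _ _ Hh Hs) as Hhs.
pose proof (Rabs_mult_le _ _ _ _ Hg Hs) as Hgs.
pose proof (Rabs_mult_le _ _ _ _ Hg Hg) as Hgg.
pose proof (Rabs_mult_le _ _ _ _ Hg Hh) as Hgh.
pose proof (Rabs_mult_le _ _ _ _ Hs Hs) as Hss.
pose proof (Rabs_mult_le _ _ _ _ Rr Hs) as Hrs.
pose proof (Rabs_mult_le _ _ _ _ Hh1 Hs) as Hh1s.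
pose proof (Rabs_mult_le _ _ _ _ Hg Hg1) as Hgg1.
pose proof (Rabs_mult_le _ _ _ _ Rr Hgr) as Hrgr.
pose proof (Rabs_mult_le _ _ _ _ Rr Hhs) as Hrhs.
pose proof (Rabs_mult_le _ _ _ _ Hs Hgs) as Hsgs.
pose proof (Rabs_mult_le _ _ _ _ Hs Hhr) as Hshr.
pose proof (Rabs_mult_le _ _ _ _ Hh Hgs) as Hhgs.
pose proof (Rabs_mult_le _ _ _ _ Hh Hhr) as Hhhr.
assert (E2 : 0 < eps ^ 2 <= eps / 1000) by nra.
assert (E3 : 0 < eps ^ 3 <= eps ^ 2 / 1000) by (simpl in *; nra).
assert (Hrhs2 : Rabs (r * (g * r - h * s)) <= 6 / 10 * eps).
{ rewrite Rmult_minus_distr_l; split_abs_bounds; apply Rabs_le_between; lra. }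
assert (H6 : Rabs ((eps - eps ^ 2 / 4) * (r * (g * r - h * s))) <= 6 / 10 * eps ^ 2).
{ replace (6 / 10 * eps ^ 2) with (eps * (6 / 10 * eps)) by ring.
  apply Rabs_mult_le; [rewrite Rabs_pos_eq; lra | assumption]. }
assert (H7 : Rabs ((1 - eps / 2) * (h1 * s + h * (g * s + h * r)))
   <= 1 * (eps ^ 2 * (3 / 10))).
{ apply Rabs_mult_le; [rewrite Rabs_pos_eq; lra | ].
  rewrite Rmult_plus_distr_l; split_abs_bounds; apply Rabs_le_between; lra. }
assert (H8 : Rabs ((1 - eps / 2) * (h * s)) <= 1 * (eps / 2 * (eps / 30))).
{ apply Rabs_mult_le; [rewrite Rabs_pos_eq; lra | assumption]. }
assert (H9 : Rabs (s * (g * s + h * r)) <= eps ^ 2 * (3 / 100)).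
{ rewrite Rmult_plus_distr_l; split_abs_bounds; apply Rabs_le_between; lra. }
assert (H10 : Rabs (h * (r + s)) <= 6 / 10 * eps).
{ rewrite Rmult_plus_distr_l; split_abs_bounds; apply Rabs_le_between; lra. }
assert (H11 : Rabs (eps * (h * (r + s))) <= 6 / 10 * eps ^ 2).
{ replace (6 / 10 * eps ^ 2) with (eps * (6 / 10 * eps)) by ring.
  apply Rabs_mult_le; assumption. }
assert (H12 : 0 <= eps * (1 - r ^ 2)) by nra.
assert (H13 : 0 <= eps * (r ^ 2 - 98 / 100)) by nra.
assert (H14 : 0 <= eps ^ 2 * (1 - r ^ 2)) by nra.
assert (H14' : 0 <= eps ^ 2 * r ^ 2) by nra.
pose proof (Rabs_mult_le _ _ _ _ Re1 Hrs) as H15.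
pose proof (Rabs_mult_le _ _ _ _ Re1 Rr) as H16.
repeat split; unfold a_of_root, betatilde_of_root, U_of_root, dU_of_root, defect_of_root; 
  lazymatch goal with |- Rabs _ <= _ => apply Rabs_le_between | _ => idtac end;
  split_abs_bounds; lra.
Qed.

Lemma slowly_varying_bounds (eps r s g h g1 h1 g2 rho : R) :
  slowly_varying eps r s g h g1 h1 g2 rho ->
  (97 / 100 * rho <= a_of_root eps r g <= 101 / 100 * rho) /\
  Rabs (betatilde_of_root eps r s h) <= 8 / 10 * eps * rho /\
  (9 / 10 * eps * rho ^ 2 <= U_of_root eps r s g h g1 <= 102 / 100 * eps * rho ^ 2) /\
  Rabs (dU_of_root eps r s g h g1 h1 g2) <= 3 * eps ^ 2 * rho ^ 3 /\
  (0 <= defect_of_root eps r s g h h1 <= 12 / 10 * eps * rho ^ 2).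
Proof.
intros Hsv.
pose proof (sv_rho _ _ _ _ _ _ _ _ _ Hsv) as Hrho.
destruct (normalized_bounds _ _ _ _ _ _ _ _
            (slowly_varying_normalized _ _ _ _ _ _ _ _ _ Hsv))
  as (Ha & Hb & HU & HdU & HW).
assert (H2 : 0 < rho ^ 2) by (apply pow_lt; assumption).
assert (H3 : 0 < rho ^ 3) by (apply pow_lt; assumption).
replace (a_of_root eps r g) with (rho * a_of_root eps (r / rho) (g / rho))
  by (unfold a_of_root; field; lra).
replace (betatilde_of_root eps r s h) with
  (rho * betatilde_of_root eps (r / rho) (s / rho) (h / rho))
  by (unfold betatilde_of_root; field; lra).
replace (U_of_root eps r s g h g1) with
  (rho ^ 2 * U_of_root eps (r / rho) (s / rho) (g / rho) (h / rho) (g1 / rho ^ 2))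
  by (unfold U_of_root; field; lra).
replace (dU_of_root eps r s g h g1 h1 g2) with
  (rho ^ 3 * dU_of_root eps (r / rho) (s / rho) (g / rho) (h / rho) (g1 / rho ^ 2)
     (h1 / rho ^ 2) (g2 / rho ^ 3))
  by (unfold dU_of_root; field; lra).
replace (defect_of_root eps r s g h h1) with
  (rho ^ 2 * defect_of_root eps (r / rho) (s / rho) (g / rho) (h / rho) (h1 / rho ^ 2))
  by (unfold defect_of_root; field; lra).
rewrite !Rabs_mult, !(Rabs_pos_eq (rho ^ 3)), !(Rabs_pos_eq rho) by lra.
repeat split; nra.
Qed.

(** The two conditions of [lens_inward], with [kap] between [20 eps rho] and
    [21 eps rho].  At the corner [4 a U], of order [eps * rho^3], beats [U'], of
    order [eps^2 * rho^3], and the term with [v], which is small because the height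
    [U / T] is at most a fraction of [rho].  At the top the term of order
    [20 eps rho^2] beats [v].  Since [T] is about [20 eps rho] and [U / T] about
    [rho / 20], smallness of [eps] gives [T < U / T], that is, a center below the
    real axis. *)
Lemma lens_conditions (eps r s g h g1 h1 g2 rho kap v : R) :
  slowly_varying eps r s g h g1 h1 g2 rho ->
  20 * eps * rho <= kap <= 21 * eps * rho ->
  Rabs v <= eps * rho ^ 2 / 16 ->
  let a := a_of_root eps r g in
  let U := U_of_root eps r s g h g1 in
  let T := betatilde_of_root eps r s h + kap in
  (19 * eps * rho <= T <= 22 * eps * rho) /\ T < U / T /\
  (9 / 10 * eps * rho ^ 2 <= U <= 102 / 100 * eps * rho ^ 2) /\
  0 < dU_of_root eps r s g h g1 h1 g2 + 4 * a * U + (T - U / T) * v /\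
  2 * Rabs v < 20 * eps * rho * (g + 2 * a).
Proof.
intros Hsv Hk Hv.
destruct (slowly_varying_bounds _ _ _ _ _ _ _ _ _ Hsv) as (Ha & Hb & HU & HdU & _).
destruct Hsv as [He Hr Hrho Hm Hs' Hi Hg Hh Hg1 Hh1 Hg2].
intros a U T; fold a in Ha; fold U in HU.
assert (Her : 0 < eps * rho) by (apply Rmult_lt_0_compat; lra).
assert (Hr2 : 0 < rho ^ 2) by (apply pow_lt; assumption).
assert (Hr3 : 0 < rho ^ 3) by (apply pow_lt; assumption).
assert (Her2 : 0 < eps * rho ^ 2) by (apply Rmult_lt_0_compat; lra).
assert (Her3 : 0 < eps * rho ^ 3) by (apply Rmult_lt_0_compat; lra).
assert (HT : 19 * eps * rho <= T <= 22 * eps * rho) by (unfold T; split_abs_bounds; lra).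
set (D := U / T).
assert (HD : D * T = U) by (unfold D; field; lra).
assert (HD1 : T < D).
{ apply (Rmult_lt_reg_r T); [lra | ]; rewrite HD.
  apply Rle_lt_trans with ((22 * eps * rho) * (22 * eps * rho)); [nra | ].
  assert (eps * (eps * rho ^ 2) < 1 / 1000 * (eps * rho ^ 2))
    by (apply Rmult_lt_compat_r; lra).
  lra. }
assert (HD2 : D <= 6 / 100 * rho).
{ apply (Rmult_le_reg_r T); [lra | ]; rewrite HD.
  apply Rle_trans with (6 / 100 * rho * (19 * eps * rho)); [nra | ].
  apply Rmult_le_compat_l; lra. }
assert (Hvv : Rabs ((T - D) * v) <= 6 / 100 * rho * (eps * rho ^ 2 / 16)).
{ apply Rabs_mult_le; [ | assumption]; apply Rabs_le_between; lra. }
assert (HaU : 97 / 100 * rho * (9 / 10 * eps * rho ^ 2) <= a * U)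
  by (apply Rmult_le_compat; nra).
assert (eps * (eps * rho ^ 3) < 1 / 1000 * (eps * rho ^ 3))
  by (apply Rmult_lt_compat_r; lra).
repeat split; try lra; split_abs_bounds; try lra.
assert (eps * rho < 1 / 1000 * rho) by (apply Rmult_lt_compat_r; lra).
apply Rlt_le_trans with (20 * eps * rho * rho); [ | apply Rmult_le_compat_l; lra].
assert (Rabs v <= eps * rho ^ 2 / 16) by (apply Rabs_le_between; lra).
lra.
Qed.

(** * Derivatives of complex-valued functions of a real variable *)

Definition is_derive_RC (f : R -> Complex.C) (u : R) (l : Complex.C) : Prop :=
  is_derive (fun t => Re (f t)) u (Re l) /\ is_derive (fun t => Im (f t)) u (Im l).

Lemma is_derive_RC_unique f u l : is_derive_RC f u l -> Derive_RC f u = l.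
Proof.
intros [H1 H2]; apply injective_projections; apply is_derive_unique; assumption.
Qed.

Lemma is_derive_RC_ext_loc f1 f2 u l :
  locally u (fun t => f1 t = f2 t) -> is_derive_RC f1 u l -> is_derive_RC f2 u l.
Proof.
intros He [H1 H2]; split; eapply is_derive_ext_loc; try eassumption;
  (apply (filter_imp (fun t => f1 t = f2 t)); [ | assumption]); intros t ->; reflexivity.
Qed.

Lemma is_derive_RC_const z u : is_derive_RC (fun _ => z) u (RtoC 0).
Proof. split; apply (is_derive_const (V := R_NormedModule)). Qed.

Lemma is_derive_RC_minus f1 f2 u l1 l2 :
  is_derive_RC f1 u l1 -> is_derive_RC f2 u l2 ->
  is_derive_RC (fun t => f1 t - f2 t)%C u (l1 - l2)%C.
Proof.
intros [H1 H2] [H3 H4]; split;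
 [exact (is_derive_minus _ _ _ _ _ H1 H3) | exact (is_derive_minus _ _ _ _ _ H2 H4)].
Qed.

Ltac rewrite_Derive := repeat match goal with
  | H : is_derive ?f ?u ?l |- context [Derive (fun x => ?f x) ?u] =>
    replace (Derive (fun x : R => f x) u) with l
      by (symmetry; exact (is_derive_unique f u l H))
  end.

(** With [sgn = -1] and [sgn = 1], the real and the imaginary part of a complex
    product. *)
Lemma is_derive_bilinear (sgn : R) (p q p' q' : R -> R) (u dp dq dp' dq' : R) :
  is_derive p u dp -> is_derive q u dq -> is_derive p' u dp' -> is_derive q' u dq' ->
  is_derive (fun t => p t * p' t + sgn * (q t * q' t)) u
    (dp * p' u + p u * dp' + sgn * (dq * q' u + q u * dq')).
Proof.
intros H1 H2 H3 H4; auto_derive.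
- repeat split; eexists; eassumption.
- rewrite_Derive; ring.
Qed.

Lemma is_derive_RC_mult f1 f2 u l1 l2 :
  is_derive_RC f1 u l1 -> is_derive_RC f2 u l2 ->
  is_derive_RC (fun t => f1 t * f2 t)%C u (l1 * f2 u + f1 u * l2)%C.
Proof.
intros [H1 H2] [H3 H4]; split.
- eapply is_derive_ext; [ | eapply eq_rect;
    [exact (is_derive_bilinear (-1) _ _ _ _ _ _ _ _ _ H1 H2 H3 H4) | ]].
  + intros t; simpl; unfold Re, Im; ring.
  + simpl; unfold Re, Im; ring.
- eapply is_derive_ext; [ | eapply eq_rect;
    [exact (is_derive_bilinear 1 _ _ _ _ _ _ _ _ _ H1 H2 H4 H3) | ]].
  + intros t; simpl; unfold Re, Im; ring.
  + simpl; unfold Re, Im; ring.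
Qed.

Lemma Csqnorm_pos (z : Complex.C) : z <> RtoC 0 -> 0 < fst z ^ 2 + snd z ^ 2.
Proof.
intros Hz; apply Rnot_le_lt; intros H; apply Hz.
pose proof (pow2_ge_0 (fst z)); pose proof (pow2_ge_0 (snd z)).
apply injective_projections; simpl; apply Rsqr_0_uniq; unfold Rsqr; nra.
Qed.

Lemma is_derive_inv_component (p q : R -> R) (u dp dq : R) :
  is_derive p u dp -> is_derive q u dq -> 0 < p u ^ 2 + q u ^ 2 ->
  is_derive (fun t => p t / (p t ^ 2 + q t ^ 2)) u
    ((dp * (q u ^ 2 - p u ^ 2) - 2 * p u * q u * dq) / (p u ^ 2 + q u ^ 2) ^ 2).
Proof.
intros H1 H2 Hn; auto_derive.
- repeat split; try (eexists; eassumption); lra.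
- rewrite_Derive; field; lra.
Qed.

Lemma is_derive_RC_inv f u l :
  is_derive_RC f u l -> f u <> RtoC 0 ->
  is_derive_RC (fun t => / f t)%C u (- (l / (f u * f u)))%C.
Proof.
intros [H1 H2] Hne; apply Csqnorm_pos in Hne as Hn.
assert (Hn2 : (fst (f u) * fst (f u) - snd (f u) * snd (f u)) ^ 2
   + (fst (f u) * snd (f u) + snd (f u) * fst (f u)) ^ 2 <> 0).
{ replace (_ + _) with ((fst (f u) ^ 2 + snd (f u) ^ 2) ^ 2) by ring.
  apply Rgt_not_eq, pow_lt; lra. }
split.
- eapply is_derive_ext; [ | eapply eq_rect;
    [exact (is_derive_inv_component _ _ _ _ _ H1 H2 Hn) | ]].
  + reflexivity.
  + simpl; unfold Re, Im in *; field; split; [contradict Hn2; lra | lra].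
- assert (Hn' : 0 < snd (f u) ^ 2 + fst (f u) ^ 2) by lra.
  eapply is_derive_ext; [ | eapply eq_rect;
    [exact (is_derive_opp _ _ _ (is_derive_inv_component _ _ _ _ _ H2 H1 Hn')) | ]].
  + intros t; unfold opp; simpl; unfold Re, Im, Rdiv.
    rewrite (Rplus_comm (snd (f t) * _)); ring.
  + unfold opp; simpl; unfold Re, Im in *; field; split; [contradict Hn2; lra | lra].
Qed.

Lemma Csqrt_spec (z : Complex.C) :
  0 < Re z -> (Csqrt z * Csqrt z)%C = z /\ 0 < Re (Csqrt z).
Proof.
intros Hz.
pose proof (Cmod2_alt z) as Hm; pose proof (Cmod_ge_0 z) as Hm0.
assert (Hr : 0 < sqrt ((Cmod z + Re z) / 2)) by (apply sqrt_lt_R0; lra).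
split; [ | exact Hr].
assert (Hr2 : sqrt ((Cmod z + Re z) / 2) * sqrt ((Cmod z + Re z) / 2)
   = (Cmod z + Re z) / 2) by (apply sqrt_sqrt; lra).
unfold Csqrt; set (r := sqrt _) in *.
apply injective_projections; simpl.
- change (fst z) with (Re z).
  replace (r * r - Im z / (2 * r) * (Im z / (2 * r)))
    with (r * r - Im z ^ 2 / (4 * (r * r))) by (field; lra).
  rewrite Hr2.
  replace (Im z ^ 2) with ((Cmod z - Re z) * (Cmod z + Re z)) by lra.
  field; lra.
- change (snd z) with (Im z); field; lra.
Qed.

(** Writing the value [p + i q] as [(r + i s)^2] removes all nested roots from
    the derivative. *)
Lemma is_derive_sqrt_component (p q : R -> R) (u dp dq r s : R) :
  is_derive p u dp -> is_derive q u dq ->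
  p u = r ^ 2 - s ^ 2 -> q u = 2 * r * s -> 0 < r ->
  is_derive (fun t => sqrt ((sqrt (p t ^ 2 + q t ^ 2) + p t) / 2)) u
    ((dp * r + dq * s) / (2 * (r ^ 2 + s ^ 2))) /\
  is_derive (fun t => q t / (2 * sqrt ((sqrt (p t ^ 2 + q t ^ 2) + p t) / 2))) u
    ((dq * r - dp * s) / (2 * (r ^ 2 + s ^ 2))).
Proof.
intros H1 H2 Hp Hq Hr.
assert (Hm : 0 < r ^ 2 + s ^ 2) by (pose proof (pow2_ge_0 s); nra).
assert (Hn : p u * (p u * 1) + q u * (q u * 1) = (r ^ 2 + s ^ 2) ^ 2)
  by (rewrite Hp, Hq; ring).
assert (Hs1 : sqrt (p u * (p u * 1) + q u * (q u * 1)) = r ^ 2 + s ^ 2)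
  by (rewrite Hn; apply sqrt_pow2; lra).
assert (Hs2 : sqrt ((r ^ 2 + s ^ 2 + p u) * / 2) = r).
{ rewrite Hp; replace (_ * / 2) with (r ^ 2) by field; apply sqrt_pow2; lra. }
assert (0 < (r ^ 2 + s ^ 2) ^ 2) by (apply pow_lt; lra).
assert (0 < (r ^ 2 + s ^ 2 + p u) * / 2) by (rewrite Hp; nra).
split; auto_derive.
- rewrite Hs1, Hn; repeat split; try (eexists; eassumption); assumption.
- rewrite Hs1, Hs2; rewrite_Derive; rewrite Hp, Hq.
  field; lra.
- rewrite Hs1, Hs2, Hn; repeat split; try (eexists; eassumption); lra.
- rewrite Hs1, Hs2; rewrite_Derive; rewrite Hp, Hq.
  field; lra.
Qed.

Lemma is_derive_RC_Csqrt V u V1 :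
  0 < Re (V u) -> is_derive_RC V u V1 ->
  is_derive_RC (fun t => Csqrt (V t)) u (V1 / (RtoC 2 * V u) * Csqrt (V u))%C.
Proof.
intros HV [H1 H2].
destruct (Csqrt_spec _ HV) as [Hsq Hpos].
set (w := Csqrt (V u)) in *; clearbody w.
destruct (is_derive_sqrt_component _ _ u _ _ (Re w) (Im w) H1 H2) as [K1 K2];
  [rewrite <- Hsq; simpl; unfold Re, Im; ring
  |rewrite <- Hsq; simpl; unfold Re, Im; ring | assumption | ].
assert (Hw : w <> RtoC 0) by (intros E; rewrite E in Hpos; simpl in Hpos; lra).
replace (V1 / (RtoC 2 * V u) * w)%C with (V1 * / (RtoC 2 * w))%C
  by (rewrite <- Hsq; field; exact Hw).
assert (Hn := Csqnorm_pos w Hw).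
split.
- eapply is_derive_ext; [ | eapply eq_rect; [exact K1 | ]].
  + reflexivity.
  + simpl; unfold Re, Im in *; field; nra.
- eapply is_derive_ext; [ | eapply eq_rect; [exact K2 | ]].
  + reflexivity.
  + simpl; unfold Re, Im in *; field; nra.
Qed.

(** * The approximate solution in terms of the root of the potential *)

(** Convexity is what lets the integrals from a base point in [D] be
    differentiated at every point of [D]. *)
Record thrice_differentiable (D : R -> Prop) (V V1 V2 V3 : R -> Complex.C) : Prop := {
  td_open : forall u, D u -> locally u D;
  td_convex : forall x y z, D x -> D y -> x <= z <= y -> D z;
  td_re : forall u, D u -> 0 < Re (V u);
  td_1 : forall u, D u -> is_derive_RC V u (V1 u);
  td_2 : forall u, D u -> is_derive_RC V1 u (V2 u);
  td_3 : forall u, D u -> is_derive_RC V2 u (V3 u)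
}.

(** The logarithmic derivative [V' / (2 V) = w' / w] of the root [w] of [V],
    and its first two derivatives, as rational functions of [V] and its
    derivatives. *)
Definition logder (V V1 : R -> Complex.C) (u : R) : Complex.C :=
  (V1 u * / (RtoC 2 * V u))%C.
Definition logder1 (V V1 V2 : R -> Complex.C) (u : R) : Complex.C :=
  (V2 u * / (RtoC 2 * V u) - RtoC 2 * (logder V V1 u * logder V V1 u))%C.
Definition logder2 (V V1 V2 V3 : R -> Complex.C) (u : R) : Complex.C :=
  (V3 u * / (RtoC 2 * V u) - RtoC 2 * (V2 u * / (RtoC 2 * V u)) * logder V V1 u
   - RtoC 4 * logder V V1 u * logder1 V V1 V2 u)%C.

Lemma Re_pos_neq_0 (z : Complex.C) : 0 < Re z -> z <> RtoC 0.
Proof. intros H E; rewrite E in H; simpl in H; lra. Qed.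

Lemma is_derive_RC_eq f u l l' : is_derive_RC f u l -> l = l' -> is_derive_RC f u l'.
Proof. intros H <-; exact H. Qed.

Lemma is_derive_eq (f : R -> R) (u l l' : R) : is_derive f u l -> l = l' -> is_derive f u l'.
Proof. intros H <-; exact H. Qed.

Definition forcing (eps p : R) (V : R -> Complex.C) (u : R) : R :=
  RInt (fun x => Defs.sigma eps p V x * Im (V x - Vtilde eps V x)%C) p u.

Section Root.
Context (D : R -> Prop) (V V1 V2 V3 : R -> Complex.C).
Context (HV : thrice_differentiable D V V1 V2 V3).

Let r u := Re (Csqrt (V u)).
Let s u := Im (Csqrt (V u)).
Let g u := Re (logder V V1 u).
Let h u := Im (logder V V1 u).
Let g1 u := Re (logder1 V V1 V2 u).
Let h1 u := Im (logder1 V V1 V2 u).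
Let g2 u := Re (logder2 V V1 V2 V3 u).
Let h2 u := Im (logder2 V V1 V2 V3 u).
Let rho u := sqrt (Cmod (V u)).

Lemma derive_over_2V W W' u : D u -> is_derive_RC W u W' ->
  is_derive_RC (fun t => W t * / (RtoC 2 * V t))%C u
    (W' * / (RtoC 2 * V u) - RtoC 2 * (W u * / (RtoC 2 * V u)) * logder V V1 u)%C.
Proof.
intros Hu HW.
assert (Hne := Re_pos_neq_0 _ (td_re _ _ _ _ _ HV u Hu)).
eapply is_derive_RC_eq.
- apply is_derive_RC_mult; [exact HW | ].
  apply is_derive_RC_inv.
  + apply is_derive_RC_mult; [apply is_derive_RC_const | apply (td_1 _ _ _ _ _ HV u Hu)].
  + apply Cmult_neq_0; [injection; lra | exact Hne].
- unfold logder; field; exact Hne.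
Qed.

Lemma derive_logder u : D u -> is_derive_RC (logder V V1) u (logder1 V V1 V2 u).
Proof.
intros Hu; eapply is_derive_RC_eq.
- apply (derive_over_2V V1 _ u Hu (td_2 _ _ _ _ _ HV u Hu)).
- unfold logder1; fold (logder V V1 u); ring.
Qed.

Lemma derive_logder1 u : D u -> is_derive_RC (logder1 V V1 V2) u (logder2 V V1 V2 V3 u).
Proof.
intros Hu; eapply is_derive_RC_eq.
- apply is_derive_RC_minus;
    [apply (derive_over_2V V2 _ u Hu (td_3 _ _ _ _ _ HV u Hu)) | ].
  apply is_derive_RC_mult; [apply is_derive_RC_const | ].
  apply is_derive_RC_mult; apply (derive_logder u Hu).
- unfold logder2; ring.
Qed.

Lemma derive_root u : D u ->
  is_derive r u (g u * r u - h u * s u) /\ is_derive s u (g u * s u + h u * r u).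
Proof.
intros Hu.
destruct (is_derive_RC_Csqrt V u _ (td_re _ _ _ _ _ HV u Hu) (td_1 _ _ _ _ _ HV u Hu))
  as [H1 H2]; split; [exact H1 | exact H2].
Qed.

Lemma root_parts u : D u ->
  0 < r u /\ Re (V u) = r u ^ 2 - s u ^ 2 /\ Im (V u) = 2 * r u * s u /\
  Cmod (V u) = r u ^ 2 + s u ^ 2 /\ 0 < rho u /\ rho u ^ 2 = r u ^ 2 + s u ^ 2.
Proof.
intros Hu.
destruct (Csqrt_spec _ (td_re _ _ _ _ _ HV u Hu)) as [Hsq Hpos].
fold (r u) in Hpos.
assert (Hmod : Cmod (V u) = r u ^ 2 + s u ^ 2).
{ rewrite <- Hsq at 1; rewrite Cmod_mult; unfold Cmod, r, s, Re, Im; apply sqrt_sqrt.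
  apply Rplus_le_le_0_compat; apply pow2_ge_0. }
assert (0 < r u ^ 2 + s u ^ 2) by (pose proof (pow2_ge_0 (s u)); nra).
repeat split; auto.
- rewrite <- Hsq at 1; unfold r, s, Re, Im; simpl; ring.
- rewrite <- Hsq at 1; unfold r, s, Re, Im; simpl; ring.
- apply sqrt_lt_R0; lra.
- unfold rho; rewrite pow2_sqrt; lra.
Qed.

Lemma derive_rho u : D u -> is_derive rho u (rho u * g u).
Proof.
intros Hu.
destruct (derive_root u Hu) as [Hr Hs].
destruct (root_parts u Hu) as (Hr0 & _ & _ & _ & Hrho & Hrho2).
apply (is_derive_ext_loc (fun t => sqrt (r t ^ 2 + s t ^ 2))).
- apply (filter_imp D); [ | apply (td_open _ _ _ _ _ HV u Hu)]; intros t Ht.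
  destruct (root_parts t Ht) as (_ & _ & _ & E & _); unfold rho; rewrite E; reflexivity.
- assert (Hq : sqrt (r u ^ 2 + s u ^ 2) = rho u)
    by (rewrite <- Hrho2; apply sqrt_pow2; lra).
  assert (K : is_derive (fun t => r t ^ 2 + s t ^ 2) u (2 * g u * rho u ^ 2)).
  { rewrite Hrho2; clear Hr0 Hrho Hrho2 Hq; clearbody r s g h; auto_derive.
    - repeat split; eexists; eassumption.
    - rewrite_Derive; ring. }
  eapply is_derive_eq.
  + apply is_derive_sqrt; [exact K | rewrite <- Hrho2; apply pow_lt, Hrho].
  + cbv beta; rewrite Hq; field; lra.
Qed.

Lemma driving_parts eps u :
  driving eps V u = (- (eps / 2) * r u, - (eps / 2) * r u).
Proof.
unfold driving; fold (r u); generalize (r u); intros x.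
apply injective_projections; simpl; ring.
Qed.

Lemma Derive_V u : D u -> Derive_RC V u = V1 u.
Proof. intros Hu; apply is_derive_RC_unique, (td_1 _ _ _ _ _ HV u Hu). Qed.

Lemma Derive2_V u : D u -> Derive_RC (Derive_RC V) u = V2 u.
Proof.
intros Hu; apply is_derive_RC_unique, (is_derive_RC_ext_loc V1).
- apply (filter_imp D); [ | apply (td_open _ _ _ _ _ HV u Hu)].
  intros t Ht; symmetry; apply Derive_V, Ht.
- apply (td_2 _ _ _ _ _ HV u Hu).
Qed.

Lemma Derive3_V u : D u -> Derive_RC (Derive_RC (Derive_RC V)) u = V3 u.
Proof.
intros Hu; apply is_derive_RC_unique, (is_derive_RC_ext_loc V2).
- apply (filter_imp D); [ | apply (td_open _ _ _ _ _ HV u Hu)].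
  intros t Ht; symmetry; apply Derive2_V, Ht.
- apply (td_3 _ _ _ _ _ HV u Hu).
Qed.

Lemma ytilde_parts eps u : D u ->
  afun eps V u = a_of_root eps (r u) (g u) /\
  betatilde eps V u = betatilde_of_root eps (r u) (s u) (h u).
Proof.
intros Hu.
assert (Hne := Re_pos_neq_0 _ (td_re _ _ _ _ _ HV u Hu)).
unfold afun, betatilde, ytilde; rewrite driving_parts, (Derive_V u Hu).
replace (V1 u / (RtoC 4 * V u))%C with (logder V V1 u * RtoC (/ 2))%C.
2: { unfold logder; replace (RtoC 4) with (RtoC 2 * RtoC 2)%C
       by (rewrite <- RtoC_mult; f_equal; ring).
     rewrite RtoC_inv by lra; field; exact Hne. }
change (Csqrt (V u)) with (r u, s u); change (logder V V1 u) with (g u, h u).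
unfold a_of_root, betatilde_of_root; generalize (r u) (s u) (g u) (h u); intros.
unfold Re, Im; split; simpl; field.
Qed.

Lemma derive_a eps u : D u ->
  is_derive (afun eps V) u ((1 - eps / 2) * (g u * r u - h u * s u) - g1 u / 2).
Proof.
intros Hu.
apply (is_derive_ext_loc (fun t => a_of_root eps (r t) (g t))).
- apply (filter_imp D); [ | apply (td_open _ _ _ _ _ HV u Hu)].
  intros t Ht; symmetry; apply ytilde_parts, Ht.
- destruct (derive_root u Hu) as [Hr _]; destruct (derive_logder u Hu) as [Hg _].
  change (is_derive g u (g1 u)) in Hg.
  unfold a_of_root; clearbody r g; auto_derive.
  + repeat split; eexists; eassumption.
  + rewrite_Derive; field.
Qed.

Lemma derive_betatilde eps u : D u ->
  is_derive (betatilde eps V) u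
    (g u * s u + h u * r u - h1 u / 2 - eps / 2 * (g u * r u - h u * s u)).
Proof.
intros Hu.
apply (is_derive_ext_loc (fun t => betatilde_of_root eps (r t) (s t) (h t))).
- apply (filter_imp D); [ | apply (td_open _ _ _ _ _ HV u Hu)].
  intros t Ht; symmetry; apply ytilde_parts, Ht.
- destruct (derive_root u Hu) as [Hr Hs]; destruct (derive_logder u Hu) as [_ Hh].
  change (is_derive h u (h1 u)) in Hh.
  unfold betatilde_of_root; clearbody r s h; auto_derive.
  + repeat split; eexists; eassumption.
  + rewrite_Derive; field.
Qed.

Lemma Ufun_parts eps u : D u ->
  Ufun eps V u = U_of_root eps (r u) (s u) (g u) (h u) (g1 u).
Proof.
intros Hu; unfold Ufun.
rewrite (is_derive_unique _ _ _ (derive_a eps u Hu)).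
destruct (ytilde_parts eps u Hu) as [-> _].
destruct (root_parts u Hu) as (_ & -> & _).
unfold a_of_root, U_of_root; field.
Qed.

Lemma derive_U eps u : D u ->
  is_derive (Ufun eps V) u
    (dU_of_root eps (r u) (s u) (g u) (h u) (g1 u) (h1 u) (g2 u)).
Proof.
intros Hu.
apply (is_derive_ext_loc (fun t => U_of_root eps (r t) (s t) (g t) (h t) (g1 t))).
- apply (filter_imp D); [ | apply (td_open _ _ _ _ _ HV u Hu)].
  intros t Ht; symmetry; apply Ufun_parts, Ht.
- destruct (derive_root u Hu) as [Hr Hs]; destruct (derive_logder u Hu) as [Hg Hh].
  destruct (derive_logder1 u Hu) as [Hg1 _].
  change (is_derive g u (g1 u)) in Hg.
  change (is_derive h u (h1 u)) in Hh.
  change (is_derive g1 u (g2 u)) in Hg1.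
  unfold U_of_root, dU_of_root; clearbody r s g h g1 h1 g2; auto_derive.
  + repeat split; eexists; eassumption.
  + rewrite_Derive; field.
Qed.

Lemma Derive_driving eps u : D u ->
  Derive_RC (driving eps V) u =
  (- (eps / 2) * (g u * r u - h u * s u), - (eps / 2) * (g u * r u - h u * s u)).
Proof.
intros Hu; destruct (derive_root u Hu) as [Hr _].
apply is_derive_RC_unique; split.
- apply (is_derive_ext (fun t => - (eps / 2) * r t));
    [intros t; rewrite driving_parts; reflexivity | ].
  exact (is_derive_scal r u _ _ Hr).
- apply (is_derive_ext (fun t => - (eps / 2) * r t));
    [intros t; rewrite driving_parts; reflexivity | ].
  exact (is_derive_scal r u _ _ Hr).
Qed.

(** Since [V'' / V = 2 q' + 4 q^2], all terms of [V - Vtilde] that do not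
    involve the driving function are of second order; the leading term
    [- 2 f w] has imaginary part [eps * r * (r + s)], of first order because of
    the imaginary component of the factor [1 + i] in [f]. *)
Lemma Im_defect eps u : D u ->
  Im (V u - Vtilde eps V u)%C = defect_of_root eps (r u) (s u) (g u) (h u) (h1 u).
Proof.
intros Hu.
assert (Hne := Re_pos_neq_0 _ (td_re _ _ _ _ _ HV u Hu)).
destruct (Csqrt_spec _ (td_re _ _ _ _ _ HV u Hu)) as [Hsq _].
unfold Vtilde; rewrite (Derive_V u Hu), (Derive2_V u Hu), (Derive_driving eps u Hu).
set (f := driving eps V u); set (w := Csqrt (V u)) in *.
set (f' := (_, _) : Complex.C).
transitivity (Im (RtoC (1 / 2) * logder1 V V1 V2 u
   - RtoC (1 / 4) * (logder V V1 u * logder V V1 u)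
   - RtoC 2 * (w * f) - f * f + f * logder V V1 u - f')%C).
- f_equal; unfold logder1, logder; rewrite <- Hsq at 1.
  assert (E2 : RtoC (1 / 2) = (/ RtoC 2)%C) by (rewrite <- RtoC_inv by lra; f_equal; field).
  assert (E4 : RtoC (1 / 4) = (/ (RtoC 2 * RtoC 2))%C)
    by (rewrite <- RtoC_mult, <- RtoC_inv by lra; f_equal; field).
  assert (E5 : RtoC (5 / 16)
    = ((RtoC 2 * RtoC 2 + RtoC 1) / (RtoC 2 * RtoC 2 * RtoC 2 * RtoC 2))%C)
    by (rewrite <- !RtoC_mult, <- RtoC_plus, <- RtoC_div by lra; f_equal; field).
  rewrite E2, E4, E5; field; exact Hne.
- unfold f, f', w; rewrite driving_parts.
  unfold defect_of_root; change (Csqrt (V u)) with (r u, s u).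
  change (logder V V1 u) with (g u, h u); change (logder1 V V1 V2 u) with (g1 u, h1 u).
  generalize (r u) (s u) (g u) (h u) (g1 u) (h1 u); intros.
  unfold Im; simpl; field.
Qed.

Lemma derive_sigma eps p u : D p -> D u ->
  is_derive (Defs.sigma eps p V) u (2 * a_of_root eps (r u) (g u) * Defs.sigma eps p V u).
Proof.
intros Hp Hu.
destruct (root_parts u Hu) as (_ & _ & _ & _ & Hrho & _).
pose proof (derive_rho u Hu) as Hd.
assert (HJ : is_derive (fun t => RInt r p t) u (r u)).
{ apply (is_derive_RInt_on_open D); auto.
  - apply (td_open _ _ _ _ _ HV).
  - apply (td_convex _ _ _ _ _ HV).
  - intros x Hx; exact (is_derive_continuous _ _ _ (proj1 (derive_root x Hx))). }
set (J := fun t => RInt r p t) in HJ.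
change (Defs.sigma eps p V) with (fun t => / rho t * exp ((2 - eps) * J t)).
unfold a_of_root; clearbody rho J r g; auto_derive.
- repeat split; try (eexists; eassumption); lra.
- rewrite_Derive; field; lra.
Qed.

Lemma sigma_pos eps p u : D u -> 0 < Defs.sigma eps p V u.
Proof.
intros Hu; destruct (root_parts u Hu) as (_ & _ & _ & _ & Hrho & _).
apply Rmult_lt_0_compat; [apply Rinv_0_lt_compat, Hrho | apply exp_pos].
Qed.

Lemma continuous_defect eps u : D u ->
  continuous (fun t => Im (V t - Vtilde eps V t)%C) u.
Proof.
intros Hu.
destruct (derive_root u Hu) as [Hr Hs]; destruct (derive_logder u Hu) as [Hg Hh].
destruct (derive_logder1 u Hu) as [_ Hh1].
change (is_derive g u (g1 u)) in Hg.
change (is_derive h u (h1 u)) in Hh.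
change (is_derive h1 u (h2 u)) in Hh1.
apply (continuous_ext_loc _ (fun t => defect_of_root eps (r t) (s t) (g t) (h t) (h1 t))).
- apply (filter_imp D); [ | apply (td_open _ _ _ _ _ HV u Hu)].
  intros t Ht; symmetry; apply Im_defect, Ht.
- apply (ex_derive_continuous (V := R_NormedModule)).
  unfold defect_of_root; clearbody r s g h g1 h1 h2; auto_derive.
  repeat split; eexists; eassumption.
Qed.

Lemma derive_forcing eps p u : D p -> D u ->
  is_derive (forcing eps p V) u
    (Defs.sigma eps p V u * defect_of_root eps (r u) (s u) (g u) (h u) (h1 u)).
Proof.
intros Hp Hu; rewrite <- (Im_defect eps u Hu).
apply (is_derive_RInt_on_open D
  (fun x => Defs.sigma eps p V x * Im (V x - Vtilde eps V x)%C)); auto.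
- apply (td_open _ _ _ _ _ HV).
- apply (td_convex _ _ _ _ _ HV).
- intros x Hx.
  apply (continuous_mult (Defs.sigma eps p V) (fun x => Im (V x - Vtilde eps V x)%C)).
  + eapply is_derive_continuous, derive_sigma; assumption.
  + apply continuous_defect, Hx.
Qed.

(** [kappa - nu * rho] solves the linear equation
    [z' + 2 a z = Im (V - Vtilde)], of which [sigma] is the integrating factor. *)
Lemma derive_kappa eps nu p u : D p -> D u ->
  is_derive (kappa eps nu p V) u
    (nu * (rho u * g u) + defect_of_root eps (r u) (s u) (g u) (h u) (h1 u)
     - 2 * a_of_root eps (r u) (g u) * (kappa eps nu p V u - nu * rho u)).
Proof.
intros Hp Hu.
pose proof (derive_sigma eps p u Hp Hu) as Hs; pose proof (sigma_pos eps p u Hu) as Hs0.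
pose proof (derive_rho u Hu) as Hr.
pose proof (derive_forcing eps p u Hp Hu) as HJ.
set (J := forcing eps p V) in HJ.
change (kappa eps nu p V) with (fun t => nu * rho t + 1 / Defs.sigma eps p V t * J t).
set (sg := Defs.sigma eps p V) in *; clearbody sg J rho.
generalize dependent (defect_of_root eps (r u) (s u) (g u) (h u) (h1 u)); intros W HJ.
generalize dependent (a_of_root eps (r u) (g u)); intros a Hs.
auto_derive.
- repeat split; try (eexists; eassumption); lra.
- rewrite_Derive; field; lra.
Qed.

(** The integrand is nonnegative, so the integral is; and
    [eps * rho * sigma - forcing] is nondecreasing and starts positive, so the
    integral stays below [eps * rho * sigma]. *)
Lemma kappa_bounds eps nu p q :
  0 < eps -> p <= q -> (forall u, p <= u <= q -> D u) ->
  (forall u, p <= u <= q ->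
     0 <= defect_of_root eps (r u) (s u) (g u) (h u) (h1 u)
       <= eps * rho u * (g u + 2 * a_of_root eps (r u) (g u))) ->
  nu * rho q <= kappa eps nu p V q <= (nu + eps) * rho q.
Proof.
intros Heps Hpq Hin HW.
assert (Hp : D p) by (apply Hin; lra).
assert (Hq : D q) by (apply Hin; lra).
pose proof (sigma_pos eps p q Hq) as Hs0.
destruct (root_parts q Hq) as (_ & _ & _ & _ & Hrho & _).
set (J := forcing eps p V).
assert (HJp : J p = 0) by
  (apply (RInt_point p (fun x => Defs.sigma eps p V x * Im (V x - Vtilde eps V x)%C))).
assert (HJ0 : J p <= J q).
{ apply nondecreasing_of_derive with (1 := Hpq)
    (df := fun u => Defs.sigma eps p V u * defect_of_root eps (r u) (s u) (g u) (h u) (h1 u)).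
  - intros u Hu; apply derive_forcing; auto.
  - intros u Hu; apply Rmult_le_pos; [left; apply sigma_pos; auto | apply HW, Hu]. }
assert (HJ1 : eps * rho p * Defs.sigma eps p V p - J p
  <= eps * rho q * Defs.sigma eps p V q - J q).
{ apply nondecreasing_of_derive with (1 := Hpq)
    (f := fun u => eps * rho u * Defs.sigma eps p V u - J u)
    (df := fun u => Defs.sigma eps p V u * (eps * rho u * (g u + 2 * a_of_root eps (r u) (g u))
       - defect_of_root eps (r u) (s u) (g u) (h u) (h1 u))).
  - intros u Hu.
    pose proof (derive_sigma eps p u Hp (Hin u Hu)) as Hs.
    pose proof (derive_rho u (Hin u Hu)) as Hr.
    pose proof (derive_forcing eps p u Hp (Hin u Hu)) as HJ.
    fold J in HJ.
    clear HJp HJ0 Hs0 HW Hrho.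
    set (sg := Defs.sigma eps p V) in *; clearbody sg J rho.
    generalize dependent (defect_of_root eps (r u) (s u) (g u) (h u) (h1 u)); intros W HJ.
    generalize dependent (a_of_root eps (r u) (g u)); intros a Hs.
    auto_derive.
    + repeat split; eexists; eassumption.
    + rewrite_Derive; ring.
  - intros u Hu; apply Rmult_le_pos; [left; apply sigma_pos; auto | ].
    specialize (HW u Hu); lra. }
assert (Hrp : 0 < rho p) by apply (root_parts p Hp).
assert (0 < eps * rho p * Defs.sigma eps p V p).
{ apply Rmult_lt_0_compat; [apply Rmult_lt_0_compat | apply sigma_pos]; assumption. }
change (kappa eps nu p V q) with (nu * rho q + 1 / Defs.sigma eps p V q * J q).
assert (0 <= 1 / Defs.sigma eps p V q * J q).
{ apply Rmult_le_pos; [ | lra].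
  left; apply Rdiv_lt_0_compat; lra. }
assert (1 / Defs.sigma eps p V q * J q <= eps * rho q).
{ apply (Rmult_le_reg_r (Defs.sigma eps p V q)); [assumption | ].
  replace (1 / Defs.sigma eps p V q * J q * Defs.sigma eps p V q) with (J q) by (field; lra).
  lra. }
lra.
Qed.

End Root.

(** * Invariance of the lens *)

(** The arcs pass through [a + i T] and, extended below the axis, through
    [a - i D]; these are the end points of a diameter, whence the product form.
    Because [T < D], the disk is the more restrictive of the two conjugate disks
    above the real axis, so the union of the half-disks is the intersection of the
    full disks. *)
Lemma with_conj_Iregion eps nu p V u z :
  let a := afun eps V u in
  let T := betatilde eps V u + kappa eps nu p V u in
  let D := Ufun eps V u / T in
  0 < T -> T < D ->
  (with_conj (Iregion eps nu p V) u z <->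
   (Re z - a) * (Re z - a) + (Im z - T) * (Im z + D) <= 0 /\
   (Re z - a) * (Re z - a) + (- Im z - T) * (- Im z + D) <= 0).
Proof.
intros a T D HT HTD.
assert (Hdisc : forall w : Complex.C,
  Cmod (w - (a, betafun eps nu p V u))%C <= Rfun eps nu p V u <->
  (Re w - a) * (Re w - a) + (Im w - T) * (Im w + D) <= 0).
{ intros w.
  change (Rfun eps nu p V u) with ((T + D) / 2).
  change (betafun eps nu p V u) with ((T - D) / 2).
  set (bt := (T - D) / 2).
  pose proof (Cmod2_alt (w - (a, bt))%C) as H.
  pose proof (Cmod_ge_0 (w - (a, bt))%C) as H0.
  replace (Re (w - (a, bt))%C) with (Re w - a) in H by reflexivity.
  replace (Im (w - (a, bt))%C) with (Im w - bt) in H by reflexivity.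
  set (m := Cmod _) in *; clearbody m; unfold bt in H.
  split; intros K; [ | apply Rsqr_incr_0_var; unfold Rsqr; lra].
  assert (m ^ 2 <= ((T + D) / 2) ^ 2) by (apply pow_incr; lra).
  lra. }
unfold with_conj, Iregion; fold a; split.
- intros [[H1 H2] | [w [[H1 H2] ->]]]; apply Hdisc in H1.
  + split; [exact H1 | nra].
  + change (Re (Cconj w)) with (Re w); change (Im (Cconj w)) with (- Im w).
    split; [nra | rewrite Ropp_involutive; exact H1].
- intros [H1 H2]; destruct (Rle_lt_dec 0 (Im z)) as [Hz | Hz].
  + left; split; [apply Hdisc, H1 | exact Hz].
  + right; exists (Cconj z); split; [split | ].
    * apply Hdisc; exact H2.
    * change (Im (Cconj z)) with (- Im z); lra.
    * destruct z as [x y]; unfold Cconj; simpl; f_equal; ring.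
Qed.

Lemma is_derive_arc (x y T L : R -> R) (u dx dy dT dL : R) :
  is_derive x u dx -> is_derive y u dy -> is_derive T u dT -> is_derive L u dL ->
  is_derive (fun t => x t * x t + (y t - T t) * (y t + L t)) u
    (2 * x u * dx + (dy - dT) * (y u + L u) + (y u - T u) * (dy + dL)).
Proof.
intros Hx Hy HT HL; auto_derive.
- repeat split; eexists; eassumption.
- rewrite_Derive; ring.
Qed.

Section Invariance.
Context (D : R -> Prop) (V V1 V2 V3 : R -> Complex.C).
Context (HV : thrice_differentiable D V V1 V2 V3).

Let r u := Re (Csqrt (V u)).
Let s u := Im (Csqrt (V u)).
Let g u := Re (logder V V1 u).
Let h u := Im (logder V V1 u).
Let g1 u := Re (logder1 V V1 V2 u).
Let h1 u := Im (logder1 V V1 V2 u).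
Let g2 u := Re (logder2 V V1 V2 V3 u).
Let rho u := sqrt (Cmod (V u)).

(** The hypotheses on [V', V'', V'''], with [|V|] written as [rho^2], give the
    bounds on [q] and its derivatives by the triangle inequality. *)
Lemma slowly_varying_of_bounds eps u :
  D u -> 0 < eps < 1 / 1000 ->
  Cmod (V1 u) <= eps * rho u ^ 3 ->
  Cmod (V2 u) <= eps ^ 2 * rho u ^ 4 ->
  Cmod (V3 u) <= eps ^ 3 * rho u ^ 5 ->
  Rabs (s u) <= 1 / 8 * r u ->
  Rabs (Im (V u)) <= eps * rho u ^ 2 / 16 ->
  slowly_varying eps (r u) (s u) (g u) (h u) (g1 u) (h1 u) (g2 u) (rho u).
Proof.
intros Hu He B1 B2 B3 Bs Bi.
destruct (root_parts D V V1 V2 V3 HV u Hu) as (Hr & _ & Him & Hmod & Hrho & Hrho2).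
fold (r u) in *; fold (s u) in *; fold (rho u) in *.
rewrite Him in Bi.
assert (Hne := Re_pos_neq_0 _ (td_re _ _ _ _ _ HV u Hu)).
assert (Hinv : Cmod (/ (RtoC 2 * V u))%C = / (2 * rho u ^ 2)).
{ rewrite Cmod_inv by (apply Cmult_neq_0; [injection; lra | exact Hne]).
  rewrite Cmod_mult, Cmod_R, Hmod, Hrho2, Rabs_pos_eq by lra; reflexivity. }
assert (Hdiv : forall z b, Cmod z <= b * rho u ^ 2 ->
  Cmod (z * / (RtoC 2 * V u))%C <= b / 2).
{ intros z b Hz; rewrite Cmod_mult, Hinv.
  assert (0 < rho u ^ 2) by (apply pow_lt; assumption).
  apply (Rmult_le_reg_r (2 * rho u ^ 2)); [lra | ].
  rewrite Rmult_assoc, Rinv_l by lra; lra. }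
assert (Hm : forall z w p q, Cmod z <= p -> Cmod w <= q -> Cmod (z * w)%C <= p * q).
{ intros; rewrite Cmod_mult; apply Rmult_le_compat; auto using Cmod_ge_0. }
assert (Hs : forall z w p q, Cmod z <= p -> Cmod w <= q -> Cmod (z - w)%C <= p + q).
{ intros z w p q ? ?; unfold Cminus; eapply Rle_trans; [apply Cmod_triangle | ].
  rewrite Cmod_opp; lra. }
assert (Hc : forall x, 0 <= x -> Cmod (RtoC x) <= x).
{ intros x Hx; rewrite Cmod_R, Rabs_pos_eq; lra. }
assert (D1 : Cmod (logder V V1 u) <= eps * rho u / 2).
{ apply Hdiv; eapply Rle_trans; [exact B1 | right; ring]. }
assert (D2 : Cmod (V2 u * / (RtoC 2 * V u))%C <= eps ^ 2 * rho u ^ 2 / 2).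
{ apply Hdiv; eapply Rle_trans; [exact B2 | right; ring]. }
assert (D3 : Cmod (V3 u * / (RtoC 2 * V u))%C <= eps ^ 3 * rho u ^ 3 / 2).
{ apply Hdiv; eapply Rle_trans; [exact B3 | right; ring]. }
assert (L1 : Cmod (logder1 V V1 V2 u) <= eps ^ 2 * rho u ^ 2).
{ eapply Rle_trans; [apply Hs; [exact D2 | ] | ].
  - apply Hm; [apply Hc; lra | apply Hm; exact D1].
  - right; field. }
assert (L2 : Cmod (logder2 V V1 V2 V3 u) <= 3 * eps ^ 3 * rho u ^ 3).
{ eapply Rle_trans; [apply Hs; [apply Hs; [exact D3 | ] | ] | ].
  - apply Hm; [apply Hm; [apply Hc; lra | exact D2] | exact D1].
  - apply Hm; [apply Hm; [apply Hc; lra | exact D1] | exact L1].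
  - right; field. }
constructor; auto; unfold g, h, g1, h1, g2;
  (eapply Rle_trans; [first [apply re_le_Cmod | apply im_le_Cmod] | assumption]).
Qed.

Context (eps p q : R) (Hpq : p <= q) (Hin : forall u, p <= u <= q -> D u).
Context (Hslow : forall u, p <= u <= q ->
  slowly_varying eps (r u) (s u) (g u) (h u) (g1 u) (h1 u) (g2 u) (rho u)).

Let T u := betatilde eps V u + kappa eps (20 * eps) p V u.
Let v u := Im (V u).

Lemma im_V_bound u : p <= u <= q -> Rabs (v u) <= eps * rho u ^ 2 / 16.
Proof.
intros Hu; destruct (root_parts D V V1 V2 V3 HV u (Hin u Hu)) as (_ & _ & Him & _).
unfold v; rewrite Him; apply (sv_im _ _ _ _ _ _ _ _ _ (Hslow u Hu)).
Qed.

Lemma kappa_estimate u : p <= u <= q ->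
  20 * eps * rho u <= kappa eps (20 * eps) p V u <= 21 * eps * rho u.
Proof.
intros Hu.
destruct (Hslow p ltac:(lra)) as [He _ _ _ _ _ _ _ _ _ _].
destruct (kappa_bounds D V V1 V2 V3 HV eps (20 * eps) p u) as [K1 K2]; try lra.
- intros t Ht; apply Hin; lra.
- intros t Ht; fold (r t); fold (s t); fold (g t); fold (h t); fold (h1 t); fold (rho t).
  assert (Hsl := Hslow t ltac:(lra)).
  destruct (slowly_varying_bounds _ _ _ _ _ _ _ _ _ Hsl) as (Ha & _ & _ & _ & HW).
  split; [apply HW | ].
  pose proof (sv_rho _ _ _ _ _ _ _ _ _ Hsl) as Hrho.
  pose proof (sv_g _ _ _ _ _ _ _ _ _ Hsl) as Hg; apply Rabs_le_between in Hg.
  assert (eps * rho t < 1 / 1000 * rho t) by (apply Rmult_lt_compat_r; lra).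
  assert (0 < eps * rho t) by (apply Rmult_lt_0_compat; lra).
  apply Rle_trans with (eps * rho t * (12 / 10 * rho t)); [lra | ].
  apply Rmult_le_compat_l; lra.
- fold (rho u) in *; lra.
Qed.

Lemma lens_estimates u : p <= u <= q ->
  (19 * eps * rho u <= T u <= 22 * eps * rho u) /\ 0 < T u /\
  T u < Ufun eps V u / T u /\
  (9 / 10 * eps * rho u ^ 2 <= Ufun eps V u <= 102 / 100 * eps * rho u ^ 2) /\
  forall w, Rabs w <= Rabs (v u) ->
    0 < dU_of_root eps (r u) (s u) (g u) (h u) (g1 u) (h1 u) (g2 u)
        + 4 * afun eps V u * Ufun eps V u + (T u - Ufun eps V u / T u) * w /\
    w < v u + 20 * eps * rho u * (g u + 2 * afun eps V u).
Proof.
intros Hu.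
pose proof (Hslow u Hu) as Hsl.
pose proof (kappa_estimate u Hu) as Hk.
pose proof (im_V_bound u Hu) as Hv.
destruct (ytilde_parts D V V1 V2 V3 HV eps u (Hin u Hu)) as [Ea Eb].
pose proof (Ufun_parts D V V1 V2 V3 HV eps u (Hin u Hu)) as EU.
assert (Hall : forall w, Rabs w <= Rabs (v u) ->
  (19 * eps * rho u <= T u <= 22 * eps * rho u) /\
  T u < Ufun eps V u / T u /\
  (9 / 10 * eps * rho u ^ 2 <= Ufun eps V u <= 102 / 100 * eps * rho u ^ 2) /\
  0 < dU_of_root eps (r u) (s u) (g u) (h u) (g1 u) (h1 u) (g2 u)
        + 4 * afun eps V u * Ufun eps V u + (T u - Ufun eps V u / T u) * w /\
  2 * Rabs w < 20 * eps * rho u * (g u + 2 * afun eps V u)).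
{ intros w Hw; unfold T; rewrite Ea, Eb, EU.
  apply (lens_conditions eps (r u) (s u) (g u) (h u) (g1 u) (h1 u) (g2 u) (rho u));
    auto; lra. }
pose proof (Hall (v u) (Rle_refl _)) as (H1 & H2 & H3 & _ & H5).
assert (0 < eps * rho u)
  by (apply Rmult_lt_0_compat; [apply (sv_eps _ _ _ _ _ _ _ _ _ Hsl)
                               | apply (sv_rho _ _ _ _ _ _ _ _ _ Hsl)]).
repeat split; try apply H1; try apply H2; try apply H3; try lra.
- apply Hall; assumption.
- apply Rabs_le_between in H0 as Hw.
  pose proof (Rle_abs (- v u)) as Hv'; rewrite Rabs_Ropp in Hv'; lra.
Qed.

(** [T' + 2 a T] is [Im V] plus a positive multiple of [nu]: the imaginary part
    of the equation of [ytilde] contributes [Im Vtilde], the equation of [kappa]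
    the difference [Im (V - Vtilde)]. *)
Lemma derive_T u : p <= u <= q ->
  is_derive T u (v u + 20 * eps * rho u * (g u + 2 * afun eps V u)
                 - 2 * afun eps V u * T u).
Proof.
intros Hu.
assert (HuD := Hin u Hu); assert (HpD : D p) by (apply Hin; lra).
destruct (ytilde_parts D V V1 V2 V3 HV eps u HuD) as [Ea Eb].
eapply is_derive_eq.
- exact (is_derive_plus _ _ _ _ _ (derive_betatilde D V V1 V2 V3 HV eps u HuD)
    (derive_kappa D V V1 V2 V3 HV eps (20 * eps) p u HpD HuD)).
- unfold T; rewrite Ea, Eb.
  destruct (root_parts D V V1 V2 V3 HV u HuD) as (_ & _ & Him & _).
  unfold v; rewrite Him.
  fold (r u); fold (s u); fold (g u); fold (h u); fold (h1 u); fold (rho u).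
  generalize (r u) (s u) (g u) (h u) (h1 u) (rho u) (kappa eps (20 * eps) p V u); intros.
  unfold plus, a_of_root, betatilde_of_root, defect_of_root; simpl; field.
Qed.

Lemma derive_height u : p <= u <= q ->
  exists dD, is_derive (fun t => Ufun eps V t / T t) u dD /\
   T u * dD = dU_of_root eps (r u) (s u) (g u) (h u) (g1 u) (h1 u) (g2 u)
     - (v u + 20 * eps * rho u * (g u + 2 * afun eps V u) - 2 * afun eps V u * T u)
       * (Ufun eps V u / T u).
Proof.
intros Hu.
destruct (lens_estimates u Hu) as (_ & HT & _).
eexists; split.
- apply is_derive_div; [ | apply derive_T, Hu | lra].
  apply (derive_U D V V1 V2 V3 HV eps u (Hin u Hu)).
- fold (r u); fold (s u); fold (g u); fold (h u); fold (g1 u); fold (h1 u); fold (g2 u).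
  field; lra.
Qed.

(** The barrier argument for the two disks.  Complex conjugation exchanges
    them and turns [Im y] and [Im V] into their negatives, so one computation
    serves both. *)
Lemma lens_invariant :
  riccati_invariant V p q (with_conj (Iregion eps (20 * eps) p V)).
Proof.
intros v0 v1 y Hv0 Hv01 Hv1 Hy Hy0.
destruct (riccati_extension V v0 v1 y Hv01 Hy) as (y1 & y2 & Hext).
set (a := afun eps V).
set (L := fun u => Ufun eps V u / T u).
set (dT := fun u => v u + 20 * eps * rho u * (g u + 2 * a u) - 2 * a u * T u).
set (dU := fun u => dU_of_root eps (r u) (s u) (g u) (h u) (g1 u) (h1 u) (g2 u)).
set (dL := fun u => Derive L u).
set (x := fun u => y1 u - a u).
set (flow := fun w z u => 2 * x u * (Ufun eps V u - 2 * a u * x u - x u * x u + z * z)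
  + (w - 2 * (a u + x u) * z - dT u) * (z + L u)
  + (z - T u) * (w - 2 * (a u + x u) * z + dL u)).
assert (Hmem : forall u, v0 <= u <= v1 ->
  (with_conj (Iregion eps (20 * eps) p V) u (y u) <->
   x u * x u + (y2 u - T u) * (y2 u + L u) <= 0 /\
   x u * x u + (- y2 u - T u) * (- y2 u + L u) <= 0)).
{ intros u Hu; destruct (lens_estimates u ltac:(lra)) as (_ & HT & HTL & _).
  destruct (Hext u Hu) as (E1 & E2 & _).
  unfold x; rewrite E1, E2; apply with_conj_Iregion; assumption. }
assert (Hd : forall u, v0 <= u <= v1 ->
  is_derive (fun t => x t * x t + (y2 t - T t) * (y2 t + L t)) u (flow (v u) (y2 u) u) /\
  is_derive (fun t => x t * x t + (- y2 t - T t) * (- y2 t + L t)) u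
    (flow (- v u) (- y2 u) u) /\
  T u * dL u = dU u - dT u * L u).
{ intros u Hu.
  destruct (Hext u Hu) as (E1 & E2 & D1 & D2).
  assert (Hu' : p <= u <= q) by lra.
  pose proof (derive_a D V V1 V2 V3 HV eps u (Hin u Hu')) as Da.
  fold a in Da; set (da := _ - _ / 2) in Da.
  pose proof (derive_T u Hu') as DT; fold a in DT; fold (dT u) in DT.
  destruct (derive_height u Hu') as (l & DL & El).
  change (is_derive L u l) in DL.
  assert (EL : dL u = l) by exact (is_derive_unique _ _ _ DL).
  assert (EU : Ufun eps V u = Re (V u) - a u ^ 2 - da)
    by (unfold Ufun; rewrite <- (is_derive_unique _ _ _ Da); reflexivity).
  assert (F1 : Re (V u - y u * y u)%C = Re (V u) - y1 u * y1 u + y2 u * y2 u)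
    by (rewrite E1, E2; unfold Re, Im; simpl; ring).
  assert (F2 : Im (V u - y u * y u)%C = v u - 2 * y1 u * y2 u)
    by (rewrite E1, E2; unfold v, Re, Im; simpl; ring).
  rewrite F1 in D1; rewrite F2 in D2.
  rewrite <- EL in DL, El.
  assert (Dx : is_derive x u
     (Ufun eps V u - 2 * a u * x u - x u * x u + y2 u * y2 u)).
  { eapply is_derive_eq; [exact (is_derive_minus _ _ _ _ _ D1 Da) | ].
    unfold minus, plus, opp; simpl; rewrite EU; unfold x; ring. }
  split; [ | split; [ | exact El]].
  - eapply is_derive_eq; [exact (is_derive_arc x y2 T L u _ _ _ _ Dx D2 DT DL) | ].
    unfold flow, x; ring.
  - eapply is_derive_eq;
      [exact (is_derive_arc x (fun t => - y2 t) T L u _ _ _ _ Dx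
                (is_derive_opp _ _ _ D2) DT DL) | ].
    unfold flow, x, opp; simpl; ring. }
apply Hmem; [lra | ]; apply Hmem in Hy0; [ | lra].
refine (barrier (fun t => x t * x t + (y2 t - T t) * (y2 t + L t))
  (fun t => x t * x t + (- y2 t - T t) * (- y2 t + L t))
  (fun u => flow (v u) (y2 u) u) (fun u => flow (- v u) (- y2 u) u) v0 v1
  _ _ _ _ _ (proj1 Hy0) (proj2 Hy0)).
- lra.
- intros u Hu; apply (Hd u Hu).
- intros u Hu; apply (Hd u Hu).
- intros u Hu Harc Hother.
  destruct (lens_estimates u ltac:(lra)) as (_ & HT & HTL & _ & Hw).
  destruct (Hw (v u) (Rle_refl _)) as [Hw1 Hw2].
  apply (lens_inward (a u) (v u) (T u) (Ufun eps V u) (L u) (dT u) (dU u));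
    try assumption.
  + unfold L; field; lra.
  + apply (Hd u Hu).
  + unfold dT; fold a in Hw2; lra.
  + lra.
- intros u Hu Harc Hother.
  destruct (lens_estimates u ltac:(lra)) as (_ & HT & HTL & _ & Hw).
  destruct (Hw (- v u)) as [Hw1 Hw2]; [rewrite Rabs_Ropp; lra | ].
  apply (lens_inward (a u) (- v u) (T u) (Ufun eps V u) (L u) (dT u) (dU u));
    try assumption.
  + unfold L; field; lra.
  + apply (Hd u Hu).
  + unfold dT; fold a in Hw2; lra.
  + lra.
Qed.

End Invariance.

(** * The angular Teukolsky potential *)

(** Nonnegativity of [f2] makes its infimum finite, so that the product with
    [c] is a real product. *)
Lemma pointwise_of_sup_inf (p q c : R) (f1 f2 : R -> R) (u : R) :
  0 < c -> (forall t, p <= t <= q -> 0 <= f2 t) ->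
  Rbar_le (sup_on p q f1) (Rbar_mult c (inf_on p q f2)) ->
  p <= u <= q -> f1 u <= c * f2 u.
Proof.
intros Hc Hpos Hle Hu.
destruct (Lub_Rbar_correct (fun x => exists t, p <= t <= q /\ x = f1 t)) as [Hsup _].
destruct (Glb_Rbar_correct (fun x => exists t, p <= t <= q /\ x = f2 t)) as [Hinf Hinf'].
specialize (Hsup (f1 u) (ex_intro _ u (conj Hu eq_refl))).
specialize (Hinf (f2 u) (ex_intro _ u (conj Hu eq_refl))).
assert (H0 : Rbar_le 0 (inf_on p q f2)).
{ apply Hinf'; intros x [t [Ht ->]]; apply Hpos, Ht. }
pose proof (Rbar_le_trans _ _ _ Hsup Hle) as H.
fold (inf_on p q f2) in Hinf.
destruct (inf_on p q f2) as [i | | ]; simpl in H, H0, Hinf; try contradiction.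
apply Rle_trans with (1 := H), Rmult_le_compat_l; lra.
Qed.

Lemma Rpower_half (x : R) (n : nat) :
  0 < x -> Rpower x (INR n / 2) = sqrt x ^ n.
Proof.
intros Hx; rewrite <- Rpower_sqrt by assumption.
rewrite <- Rpower_pow by apply exp_pos.
rewrite Rpower_mult; f_equal; field.
Qed.

(** The real and the imaginary part of the potential both have this form;
    its derivatives are written out up to third order. *)
Definition trig (A B C E m u : R) :=
  A * sin u ^ 2 + B / sin u ^ 2 + C * cos u + E * (cos u / sin u ^ 2) + m.
Definition trig1 (A B C E u : R) :=
  A * (2 * sin u * cos u) - B * (2 * cos u / sin u ^ 3) - C * sin u
  - E * (1 / sin u + 2 * cos u ^ 2 / sin u ^ 3).
Definition trig2 (A B C E u : R) :=
  A * (2 * cos u ^ 2 - 2 * sin u ^ 2)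
  + B * (2 / sin u ^ 2 + 6 * cos u ^ 2 / sin u ^ 4) - C * cos u
  + E * (5 * cos u / sin u ^ 2 + 6 * cos u ^ 3 / sin u ^ 4).
Definition trig3 (A B C E u : R) :=
  - A * (8 * sin u * cos u)
  - B * (16 * cos u / sin u ^ 3 + 24 * cos u ^ 3 / sin u ^ 5) + C * sin u
  - E * (5 / sin u + 28 * cos u ^ 2 / sin u ^ 3 + 24 * cos u ^ 4 / sin u ^ 5).

Lemma derive_trig A B C E m u : sin u <> 0 ->
  is_derive (trig A B C E m) u (trig1 A B C E u) /\
  is_derive (trig1 A B C E) u (trig2 A B C E u) /\
  is_derive (trig2 A B C E) u (trig3 A B C E u).
Proof.
intros Hs.
assert (H : forall n, sin u ^ n <> 0) by (intros n; apply pow_nonzero, Hs).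
pose proof (H 2%nat) as H2; pose proof (H 3%nat) as H3; pose proof (H 4%nat) as H4.
simpl in H2, H3, H4.
unfold trig, trig1, trig2, trig3; split; [ | split]; auto_derive;
  try (repeat split; assumption); field; assumption.
Qed.

Lemma teukolsky_derivatives (s0 k : R) (Omega mu : Complex.C) :
  exists V1 V2 V3 : R -> Complex.C, forall u, 0 < u < PI ->
    is_derive_RC (teukolsky_potential s0 k Omega mu) u (V1 u) /\
    is_derive_RC V1 u (V2 u) /\ is_derive_RC V2 u (V3 u).
Proof.
pose (A := (Omega * Omega)%C).
pose (B := k ^ 2 + s0 ^ 2 - 1 / 4).
pose (C1 := - (2 * s0 * Re Omega)); pose (C2 := - (2 * s0 * Im Omega)).
pose (E := - (2 * s0 * k)).
exists (fun u => (trig1 (Re A) B C1 E u, trig1 (Im A) 0 C2 0 u)),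
  (fun u => (trig2 (Re A) B C1 E u, trig2 (Im A) 0 C2 0 u)),
  (fun u => (trig3 (Re A) B C1 E u, trig3 (Im A) 0 C2 0 u)).
intros u Hu.
assert (Hs : sin u <> 0) by (apply Rgt_not_eq, sin_gt_0; lra).
destruct (derive_trig (Re A) B C1 E (- Re mu) u Hs) as (R1 & R2 & R3).
destruct (derive_trig (Im A) 0 C2 0 (- Im mu) u Hs) as (I1 & I2 & I3).
split; [ | split; split; assumption].
split; eapply is_derive_ext; [ | exact R1 | | exact I1];
  intros t; unfold trig, teukolsky_potential, A, B, C1, C2, E, Re, Im, Rdiv; simpl; ring.
Qed.

(** The domain is a slightly larger open interval: positivity of [Re V] at the
    end points persists nearby. *)
Lemma teukolsky_thrice_differentiable (s0 k : R) (Omega mu : Complex.C) (p q : R) :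
  let V := teukolsky_potential s0 k Omega mu in
  0 < p -> p <= q -> q < PI -> (forall u, p <= u <= q -> 0 < Re (V u)) ->
  exists (D : R -> Prop) (V1 V2 V3 : R -> Complex.C),
    thrice_differentiable D V V1 V2 V3 /\ forall u, p <= u <= q -> D u.
Proof.
intros V Hp Hpq Hq Hpos.
destruct (teukolsky_derivatives s0 k Omega mu) as (V1 & V2 & V3 & HD); fold V in HD.
assert (Hloc : forall u, p <= u <= q -> locally u (fun t => 0 < t < PI /\ 0 < Re (V t))).
{ intros u Hu; apply filter_and.
  - apply filter_and; [apply open_gt | apply open_lt]; lra.
  - assert (Hc := is_derive_continuous _ _ _ (proj1 (proj1 (HD u ltac:(lra))))).
    apply Hc, open_gt, Hpos, Hu. }
destruct (Hloc p ltac:(lra)) as [e1 H1]; destruct (Hloc q ltac:(lra)) as [e2 H2].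
pose proof (cond_pos e1); pose proof (cond_pos e2).
set (D := fun t => p - e1 < t < q + e2).
assert (HP : forall t, D t -> 0 < t < PI /\ 0 < Re (V t)).
{ intros t [Ht1 Ht2]; destruct (Rlt_le_dec t p); [ | destruct (Rle_lt_dec t q)].
  - apply H1, Rabs_def1; unfold minus, plus, opp; simpl; lra.
  - split; [lra | apply Hpos; lra].
  - apply H2, Rabs_def1; unfold minus, plus, opp; simpl; lra. }
exists D, V1, V2, V3; split; [constructor | unfold D; intros; lra].
- intros t [Ht1 Ht2]; apply filter_and; [apply open_gt | apply open_lt]; assumption.
- unfold D; intros; lra.
- intros t Ht; apply HP, Ht.
- intros t Ht; apply HD, HP, Ht.
- intros t Ht; apply HD, HP, Ht.
- intros t Ht; apply HD, HP, Ht.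
Qed.

(** The power of [w] on the right is [2 - alpha / 2], which exceeds one exactly
    because [alpha < 2]; hence the bound on [Im V] is eventually negligible
    compared with [eps * |V|]. *)
Lemma large_frequency (c delta Cbig alpha w : R) :
  0 < c -> 0 < delta -> 0 < Cbig -> alpha < 2 -> 1 < w ->
  Rpower (32 * c / (delta * Cbig)) (/ (1 - alpha / 2)) < w ->
  c * w <= delta * Rpower w (2 - 3 * alpha / 2) * (Cbig / 2 * Rpower w alpha) / 16.
Proof.
intros Hc Hd HC Ha Hw HX.
assert (Hdc : 0 < delta * Cbig) by (apply Rmult_lt_0_compat; assumption).
set (X := 32 * c / (delta * Cbig)) in *.
assert (HX0 : 0 < X) by (apply Rdiv_lt_0_compat; lra).
assert (HX1 : X <= Rpower w (1 - alpha / 2)).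
{ rewrite <- (Rpower_1 X) by assumption.
  replace 1 with (/ (1 - alpha / 2) * (1 - alpha / 2)) at 1 by (field; lra).
  rewrite <- Rpower_mult; apply Rle_Rpower_l; [lra | ].
  split; [apply exp_pos | lra]. }
replace (delta * Rpower w (2 - 3 * alpha / 2) * (Cbig / 2 * Rpower w alpha) / 16)
  with (delta * Cbig / 32 * (Rpower w (2 - 3 * alpha / 2) * Rpower w alpha)) by field.
rewrite <- Rpower_plus.
replace (2 - 3 * alpha / 2 + alpha) with (1 + (1 - alpha / 2)) by field.
rewrite Rpower_plus, Rpower_1 by lra.
replace (c * w) with (delta * Cbig / 32 * (w * X)) by (unfold X; field; lra).
apply Rmult_le_compat_l; [lra | apply Rmult_le_compat_l; lra].
Qed.

Theorem proposition5p2 :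
  forall (s0 k : R),
  (exists n : nat, 2 * s0 = INR n) ->
  (exists z : Z, k - s0 = IZR z) ->
  forall c : R, 0 < c ->
  exists delta0 : R, 0 < delta0 /\
  forall delta : R, 0 < delta < delta0 ->
  exists Cmin : R, forall Cbig : R, Cmin < Cbig ->
  forall alpha : R, 4 / 3 <= alpha < 2 ->
  exists C0min : R, forall C0 : R, C0min < C0 ->
  exists c' : R, 0 < c' /\
  forall Omega mu : Complex.C,
  C0 < Cmod Omega -> Rabs (Im Omega) < c ->
  let V := teukolsky_potential s0 k Omega mu in
  let lambda := Rpower (Cmod Omega) (2 - 3 * alpha / 2) in
  let eps := delta * lambda in
  let nu := 20 * delta * lambda in
  forall u0 umin u1 : R,
  0 < u0 -> u0 < umin -> umin <= u1 -> u1 < PI ->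
  Re (V u0) = 0 ->
  / c * Cmod Omega ^ 2 <= Rabs (Re (Derive_RC V u0)) <= c * Cmod Omega ^ 2 ->
  Re (V umin) = Cbig * Rpower (Cmod Omega) alpha ->
  (forall u, umin <= u <= u1 ->
     Cbig / 2 * Rpower (Cmod Omega) alpha <= Re (V u)) ->
  (forall u, umin <= u <= u1 -> Rabs (Im (V u)) <= c * Cmod Omega) ->
  Rbar_le (sup_on umin u1 (fun u => Cmod (Derive_RC V u)))
    (Rbar_mult eps (inf_on umin u1 (fun u => Rpower (Cmod (V u)) (3 / 2)))) ->
  Rbar_le (sup_on umin u1 (fun u => Cmod (Derive_RC (Derive_RC V) u)))
    (Rbar_mult (eps ^ 2) (inf_on umin u1 (fun u => Cmod (V u) ^ 2))) ->
  Rbar_le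
    (sup_on umin u1 (fun u => Cmod (Derive_RC (Derive_RC (Derive_RC V)) u)))
    (Rbar_mult (eps ^ 3)
       (inf_on umin u1 (fun u => Rpower (Cmod (V u)) (5 / 2)))) ->
  (forall u, umin <= u <= u1 ->
     Rabs (Im (Csqrt (V u))) <= 1 / 8 * Re (Csqrt (V u))) ->
  riccati_invariant V umin u1 (with_conj (Iregion eps nu umin V)) /\
  (forall u, umin <= u <= u1 ->
     (1 / c' * lambda * sqrt (Cmod (V u))
        <= Rfun eps nu umin V u + betafun eps nu umin V u
        <= c' * lambda * sqrt (Cmod (V u))) /\
     Rabs (Rfun eps nu umin V u ^ 2 - betafun eps nu umin V u ^ 2)
       <= c' * lambda * Cmod (V u)).
Proof.
intros s0 k _ _ c Hc.
(* [eps <= delta], because the exponent [2 - 3 alpha / 2] is not positive. *)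
exists (1 / 1000); split; [lra | ]; intros delta Hdelta.
exists 0; intros Cbig HC alpha Halpha.
exists (Rmax 1 (Rpower (32 * c / (delta * Cbig)) (/ (1 - alpha / 2)))); intros C0 HC0.
assert (H19 : 0 < 1 / (19 * delta)) by (apply Rdiv_lt_0_compat; lra).
(* [lens_estimates] gives [19 eps rho <= R + beta <= 22 eps rho]. *)
exists (22 * delta + 1 / (19 * delta)); split; [lra | ].
set (c' := 22 * delta + 1 / (19 * delta)).
intros Omega mu HOm _ V lambda eps nu u0 p q Hu0 Hup Hpq Hq _ _ _ HRe HIm B1 B2 B3 Hs.
destruct (proj1 (Rmax_Rlt _ _ _) HC0) as [HC01 HC02].
assert (Hw1 : 1 < Cmod Omega) by lra.
assert (Hw2 : Rpower (32 * c / (delta * Cbig)) (/ (1 - alpha / 2)) < Cmod Omega) by lra.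
assert (Hfreq := large_frequency c delta Cbig alpha (Cmod Omega) Hc ltac:(lra) HC
  ltac:(lra) Hw1 Hw2).
fold lambda in Hfreq; fold eps in Hfreq.
assert (Hlam : 0 < lambda <= 1).
{ split; [apply exp_pos | ].
  rewrite <- (Rpower_O (Cmod Omega)) by lra; apply Rle_Rpower; lra. }
assert (Heps : 0 < eps < 1 / 1000).
{ split; [apply Rmult_lt_0_compat; lra | ].
  apply Rle_lt_trans with (delta * 1); [apply Rmult_le_compat_l | ]; lra. }
assert (HP : 0 < Rpower (Cmod Omega) alpha) by apply exp_pos.
assert (HRe0 : forall u, p <= u <= q -> 0 < Re (V u)).
{ intros u Hu; specialize (HRe u Hu).
  assert (0 < Cbig / 2 * Rpower (Cmod Omega) alpha) by (apply Rmult_lt_0_compat; lra).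
  lra. }
destruct (teukolsky_thrice_differentiable s0 k Omega mu p q ltac:(lra) Hpq Hq HRe0)
  as (D & V1 & V2 & V3 & HV & Hin).
fold V in HV.
assert (Hmod : forall u, p <= u <= q -> Re (V u) <= Cmod (V u) /\ 0 < Cmod (V u)).
{ intros u Hu; specialize (HRe0 u Hu).
  pose proof (Rle_trans _ _ _ (Rle_abs _) (re_le_Cmod (V u))); lra. }
assert (Hslow : forall u, p <= u <= q ->
  slowly_varying eps (Re (Csqrt (V u))) (Im (Csqrt (V u))) (Re (logder V V1 u))
    (Im (logder V V1 u)) (Re (logder1 V V1 V2 u)) (Im (logder1 V V1 V2 u))
    (Re (logder2 V V1 V2 V3 u)) (sqrt (Cmod (V u)))).
{ intros u Hu; destruct (Hmod u Hu) as [Hm1 Hm2].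
  assert (He2 : 0 < eps ^ 2) by (apply pow_lt; lra).
  assert (He3 : 0 < eps ^ 3) by (apply pow_lt; lra).
  assert (Hsq : sqrt (Cmod (V u)) ^ 2 = Cmod (V u)) by (apply pow2_sqrt; lra).
  apply (slowly_varying_of_bounds D V V1 V2 V3 HV eps u (Hin u Hu) Heps).
  - rewrite <- (Derive_V D V V1 V2 V3 HV u (Hin u Hu)), <- Rpower_half by assumption.
    replace (INR 3 / 2) with (3 / 2) by (simpl; field).
    apply (pointwise_of_sup_inf p q eps _ _ u (proj1 Heps)) with (2 := B1) (3 := Hu).
    intros t _; left; apply exp_pos.
  - rewrite <- (Derive2_V D V V1 V2 V3 HV u (Hin u Hu)).
    replace (sqrt (Cmod (V u)) ^ 4) with ((sqrt (Cmod (V u)) ^ 2) ^ 2) by ring.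
    rewrite Hsq.
    apply (pointwise_of_sup_inf p q (eps ^ 2) _ _ u He2) with (2 := B2) (3 := Hu).
    intros t _; apply pow2_ge_0.
  - rewrite <- (Derive3_V D V V1 V2 V3 HV u (Hin u Hu)), <- Rpower_half by assumption.
    replace (INR 5 / 2) with (5 / 2) by (simpl; field).
    apply (pointwise_of_sup_inf p q (eps ^ 3) _ _ u He3) with (2 := B3) (3 := Hu).
    intros t _; left; apply exp_pos.
  - apply Hs, Hu.
  - rewrite Hsq; apply Rle_trans with (1 := HIm u Hu), Rle_trans with (1 := Hfreq).
    assert (eps * (Cbig / 2 * Rpower (Cmod Omega) alpha) <= eps * Cmod (V u)).
    { apply Rmult_le_compat_l; [lra | ]; specialize (HRe u Hu); lra. }
    lra. }
replace nu with (20 * eps) by (unfold nu, eps; ring).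
split; [exact (lens_invariant D V V1 V2 V3 HV eps p q Hpq Hin Hslow) | ].
intros u Hu; destruct (Hmod u Hu) as [_ Hm2].
destruct (lens_estimates D V V1 V2 V3 HV eps p q Hpq Hin Hslow u Hu)
  as (HT & HT0 & _ & HU & _).
set (T := betatilde eps V u + kappa eps (20 * eps) p V u) in *.
assert (Hsum : Rfun eps (20 * eps) p V u + betafun eps (20 * eps) p V u = T)
  by apply Rfun_plus_betafun.
assert (Hprod : Rfun eps (20 * eps) p V u ^ 2 - betafun eps (20 * eps) p V u ^ 2
   = Ufun eps V u).
{ replace (_ - _) with ((Rfun eps (20 * eps) p V u + betafun eps (20 * eps) p V u)
    * (Rfun eps (20 * eps) p V u - betafun eps (20 * eps) p V u)) by ring.
  rewrite Rfun_minus_betafun, Hsum; field; lra. }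
rewrite Hsum, Hprod.
assert (Hrho : 0 < sqrt (Cmod (V u))) by (apply sqrt_lt_R0, Hm2).
rewrite pow2_sqrt in HU by lra.
assert (Hc' : 1 / c' <= 19 * delta).
{ apply (Rmult_le_reg_r c'); [unfold c'; lra | ].
  replace (1 / c' * c') with (19 * delta * (1 / (19 * delta)))
    by (field; split; [unfold c' | ]; lra).
  apply Rmult_le_compat_l; unfold c'; lra. }
assert (Hls : 0 < lambda * sqrt (Cmod (V u))) by (apply Rmult_lt_0_compat; lra).
assert (Hlm : 0 < lambda * Cmod (V u)) by (apply Rmult_lt_0_compat; lra).
assert (H0 : 0 < eps * Cmod (V u)) by (apply Rmult_lt_0_compat; lra).
split; [split | ].
- rewrite Rmult_assoc.
  apply Rle_trans with (19 * delta * (lambda * sqrt (Cmod (V u))));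
    [apply Rmult_le_compat_r | unfold eps in HT]; lra.
- rewrite Rmult_assoc.
  apply Rle_trans with (22 * delta * (lambda * sqrt (Cmod (V u))));
    [unfold eps in HT | apply Rmult_le_compat_r; unfold c']; lra.
- rewrite Rabs_pos_eq, Rmult_assoc by lra.
  apply Rle_trans with (22 * delta * (lambda * Cmod (V u)));
    [ | apply Rmult_le_compat_r; unfold c'; lra].
  assert (eps * Cmod (V u) = delta * (lambda * Cmod (V u))) by (unfold eps; ring).
  lra.
Qed.
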